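(* Let $\mathbb X$ be a complex Banach space, $A$ a closed linear operator on $\mathbb X$, $\mathcal B$ an autonomous bounded linear operator on $BUC(\mathbb R,\mathbb X)$, and $f:\mathbb R\to\mathbb X$ almost periodic. Let $u\in AP(\mathbb X)$ be a strong mild solution of $\dot u(t)=Au(t)+[\mathcal Bu](t)+f(t)$, $t\in\mathbb R$, and let $\sigma_i(\mathcal A+\mathcal B)$ be finite. Then there exists a mild solution $u_f\in AP(\mathbb X)$ of this equation such that $\sigma_b(u_f)=\sigma_b(f)$.
   Context: $BUC(\mathbb R,\mathbb X)$ is the Banach space of bounded uniformly continuous functions $\mathbb R\to\mathbb X$ with sup-norm; $(S(t)g)(s)=g(t+s)$ is the translation group on it. $AP(\mathbb X)$ is the space of (Bohr) almost periodic functions $\mathbb R\to\mathbb X$. A bounded linear operator $\mathcal B$ on $BUC(\mathbb R,\mathbb X)$ is autonomous if $\mathcal BS(t)=S(t)\mathcal B$ for all $t\in\mathbb R$. $\mathcal A$ is the operator on $BUC(\mathbb R,\mathbb X)$ with domain $D(\mathcal A)=\{g\in BUC(\mathbb R,\mathbb X): g(t)\in D(A)\ \forall t\in\mathbb R,\ Ag(\cdot)\in BUC(\mathbb R,\mathbb X)\}$ and $[\mathcal Ag](t)=Ag(t)$; $\mathcal A+\mathcal B$ is considered on $BUC(\mathbb R,\mathbb X)$ with domain $D(\mathcal A)$. For an operator $T$ in a Banach space, $\sigma_i(T):=\{\xi\in\mathbb R: i\xi\in\sigma(T)\}$. For $g\in AP(\mathbb X)$ and $\lambda\in\mathbb R$,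 $a(\lambda,g):=\lim_{T\to\infty}\frac1{2T}\int_{-T}^Te^{-i\lambda t}g(t)\,dt$ (the limit exists), and the Bohr spectrum is $\sigma_b(g):=\{\lambda\in\mathbb R:a(\lambda,g)\ne0\}$. Solutions of $\dot u(t)=Au(t)+[\mathcal Bu](t)+f(t)$ for $f\in BUC(\mathbb R,\mathbb X)$: $u\in BUC(\mathbb R,\mathbb X)$ is a mild solution if for all $t\in\mathbb R$, $\int_0^tu(\xi)\,d\xi\in D(A)$ and $u(t)-u(0)=A\int_0^tu(\xi)\,d\xi+\int_0^t\big([\mathcal Bu](\xi)+f(\xi)\big)\,d\xi$. It is a classical solution if $\dot u$ exists as an element of $BUC(\mathbb R,\mathbb X)$, $u(t)\in D(A)$ for all $t$, and the equation holds for all $t$. It is a strong mild solution if there are $f_n\in BUC(\mathbb R,\mathbb X)$ and classical solutions $u_n$ of the equation with $f$ replaced by $f_n$ such that $u_n\to u$ and $f_n\to f$ in the sup-norm. *)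

(* Defs.v *)
From Stdlib Require Import Reals Lra Psatz FunctionalExtensionality ProofIrrelevance.
From Coquelicot Require Import Coquelicot.

Local Open Scope R_scope.

Notation complex_banach := (CompleteNormedModule C_AbsRing).

(* Coquelicot's [RInt] and its derivatives along [R] want modules over
   [R_AbsRing]; [realify X] is [X] with the same group, balls and norm, the
   scalars being restricted to the reals. *)
Section Realify.

Variable X : complex_banach.

Definition realify_scal (a : R) (x : X) : X := scal (RtoC a) x.

Lemma realify_scal_assoc (a b : R) (x : X) :
  realify_scal a (realify_scal b x) = realify_scal (mult a b) x.
Proof.
  unfold realify_scal. rewrite scal_assoc. f_equal.
  symmetry. apply RtoC_mult.
Qed.

Lemma realify_scal_one (x : X) : realify_scal one x = x.
Proof. exact (scal_one x). Qed.

Lemma realify_scal_distr_l (a : R) (x y : X) :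
  realify_scal a (plus x y) = plus (realify_scal a x) (realify_scal a y).
Proof. exact (scal_distr_l (RtoC a) x y). Qed.

Lemma realify_scal_distr_r (a b : R) (x : X) :
  realify_scal (plus a b) x = plus (realify_scal a x) (realify_scal b x).
Proof.
  unfold realify_scal. etransitivity; [|apply (scal_distr_r (RtoC a) (RtoC b) x)].
  f_equal. apply RtoC_plus.
Qed.

Definition realify_ModuleSpace_mixin :=
  ModuleSpace.Mixin R_Ring X realify_scal realify_scal_assoc realify_scal_one
    realify_scal_distr_l realify_scal_distr_r.

Definition realify_NormedModuleAux : NormedModuleAux R_AbsRing :=
  NormedModuleAux.Pack R_AbsRing X
    (NormedModuleAux.Class R_AbsRing X
       (ModuleSpace.Class R_Ring X (AbelianGroup.class X)
          realify_ModuleSpace_mixin)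
       (UniformSpace.class X)) X.

Lemma realify_norm_scal (a : R) (x : X) :
  norm (realify_scal a x) <= abs a * norm x.
Proof.
  eapply Rle_trans; [apply (norm_scal (RtoC a) x)|].
  apply Req_le. f_equal. exact (Cmod_R a).
Qed.

Definition realify_NormedModule_mixin :
  NormedModule.mixin_of R_AbsRing realify_NormedModuleAux :=
  NormedModule.Mixin R_AbsRing realify_NormedModuleAux
    (fun x : X => norm x) (@norm_factor _ X)
    (@norm_triangle _ X) realify_norm_scal
    (@norm_compat1 _ X) (@norm_compat2 _ X) (@norm_eq_zero _ X).

Definition realify : CompleteNormedModule R_AbsRing :=
  CompleteNormedModule.Pack R_AbsRing X
    (CompleteNormedModule.Class R_AbsRing X
       (NormedModule.Class R_AbsRing X
          (NormedModuleAux.class _ realify_NormedModuleAux)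
          realify_NormedModule_mixin)
       (CompleteSpace.class X)) X.

Definition integral (g : R -> X) (a b : R) : X := @RInt realify g a b.

Definition is_time_derive (g : R -> X) (t : R) (l : X) : Prop :=
  @is_derive R_AbsRing realify g t l.

End Realify.

Arguments integral {X} g a b.
Arguments is_time_derive {X} g t l.

Section BUC.

Variable X : complex_banach.

Definition bounded_fct (g : R -> X) : Prop :=
  exists M : R, forall t : R, norm (g t) <= M.

Definition uniformly_continuous (g : R -> X) : Prop :=
  forall eps : posreal, exists delta : posreal,
    forall s t : R, Rabs (s - t) < delta -> norm (minus (g s) (g t)) < eps.

Record BUC : Type := mk_BUC {
  BUC_fct :> R -> X;
  BUC_bounded : bounded_fct BUC_fct;
  BUC_unifcont : uniformly_continuous BUC_fct }.

Lemma BUC_ext (g h : BUC) : (forall t, g t = h t) -> g = h.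
Proof.
  destruct g as [g bg ug], h as [h bh uh]; simpl; intros E.
  assert (g = h) by now apply functional_extensionality.
  subst h. f_equal; apply proof_irrelevance.
Qed.

Lemma BUC_zero_bounded : bounded_fct (fun _ => zero).
Proof. exists 0. intros _. apply Req_le, (norm_zero (V := X)). Qed.

Lemma BUC_zero_unifcont : uniformly_continuous (fun _ => zero).
Proof.
  intros eps. exists eps. intros s t _.
  rewrite minus_eq_zero. eapply Rle_lt_trans; [|apply cond_pos].
  apply Req_le, (norm_zero (V := X)).
Qed.

Definition BUC_zero : BUC := mk_BUC _ BUC_zero_bounded BUC_zero_unifcont.

Lemma BUC_plus_bounded (g h : BUC) : bounded_fct (fun t => plus (g t) (h t)).
Proof.
  destruct (BUC_bounded g) as [M HM], (BUC_bounded h) as [N HN].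
  exists (M + N). intros t.
  eapply Rle_trans; [apply (norm_triangle (V := X))|].
  specialize (HM t); specialize (HN t); lra.
Qed.

Lemma minus_plus_plus (a b c d : X) :
  minus (plus a b) (plus c d) = plus (minus a c) (minus b d).
Proof.
  unfold minus. rewrite (opp_plus (G := X)), <- !(plus_assoc (G := X)). f_equal.
  rewrite !(plus_assoc (G := X)). f_equal. apply plus_comm.
Qed.

Lemma BUC_plus_unifcont (g h : BUC) :
  uniformly_continuous (fun t => plus (g t) (h t)).
Proof.
  intros eps.
  destruct (BUC_unifcont g (pos_div_2 eps)) as [d1 H1].
  destruct (BUC_unifcont h (pos_div_2 eps)) as [d2 H2].
  assert (Hd : 0 < Rmin d1 d2) by (apply Rmin_pos; apply cond_pos).
  exists (mkposreal _ Hd). simpl. intros s t Hst.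
  rewrite minus_plus_plus.
  eapply Rle_lt_trans; [apply (norm_triangle (V := X))|].
  assert (A1 := H1 s t (Rlt_le_trans _ _ _ Hst (Rmin_l _ _))).
  assert (A2 := H2 s t (Rlt_le_trans _ _ _ Hst (Rmin_r _ _))).
  simpl in *; lra.
Qed.

Definition BUC_plus (g h : BUC) : BUC :=
  mk_BUC _ (BUC_plus_bounded g h) (BUC_plus_unifcont g h).

Lemma minus_scal_scal (c : C) (a b : X) :
  minus (scal c a) (scal c b) = scal c (minus a b).
Proof. symmetry. apply (scal_minus_distr_l c a b). Qed.

Lemma BUC_scal_bounded (c : C) (g : BUC) : bounded_fct (fun t => scal c (g t)).
Proof.
  destruct (BUC_bounded g) as [M HM].
  exists (Cmod c * M). intros t.
  eapply Rle_trans; [apply (norm_scal (V := X))|].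
  apply Rmult_le_compat_l; [apply Cmod_ge_0 | apply HM].
Qed.

Lemma BUC_scal_unifcont (c : C) (g : BUC) :
  uniformly_continuous (fun t => scal c (g t)).
Proof.
  intros eps.
  assert (Hc : 0 < Cmod c + 1) by (generalize (Cmod_ge_0 c); lra).
  assert (He : 0 < eps / (Cmod c + 1))
    by (apply Rdiv_lt_0_compat; [apply cond_pos | exact Hc]).
  destruct (BUC_unifcont g (mkposreal _ He)) as [d Hd].
  exists d. intros s t Hst.
  rewrite minus_scal_scal.
  eapply Rle_lt_trans; [apply (norm_scal (V := X))|].
  change (abs c) with (Cmod c).
  specialize (Hd s t Hst); simpl in Hd.
  apply Rle_lt_trans with ((Cmod c + 1) * norm (minus (g s) (g t))).
  - apply Rmult_le_compat_r; [apply (norm_ge_0 (V := X)) | lra].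
  - replace (pos eps) with ((Cmod c + 1) * (eps / (Cmod c + 1))) by (field; lra).
    now apply Rmult_lt_compat_l.
Qed.

Definition BUC_scal (c : C) (g : BUC) : BUC :=
  mk_BUC _ (BUC_scal_bounded c g) (BUC_scal_unifcont c g).

Lemma BUC_opp_bounded (g : BUC) : bounded_fct (fun t => opp (g t)).
Proof.
  destruct (BUC_bounded g) as [M HM]. exists M. intros t.
  rewrite (norm_opp (V := X)). apply HM.
Qed.

Lemma BUC_opp_unifcont (g : BUC) : uniformly_continuous (fun t => opp (g t)).
Proof.
  intros eps. destruct (BUC_unifcont g eps) as [d Hd]. exists d.
  intros s t Hst. unfold minus.
  rewrite <- (opp_plus (G := X)), (norm_opp (V := X)). exact (Hd s t Hst).
Qed.

Definition BUC_opp (g : BUC) : BUC :=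
  mk_BUC _ (BUC_opp_bounded g) (BUC_opp_unifcont g).

Lemma BUC_plus_comm (g h : BUC) : BUC_plus g h = BUC_plus h g.
Proof. apply BUC_ext; intros t. exact (plus_comm (G := X) (g t) (h t)). Qed.

Lemma BUC_plus_assoc (g h k : BUC) :
  BUC_plus g (BUC_plus h k) = BUC_plus (BUC_plus g h) k.
Proof. apply BUC_ext; intros t. exact (plus_assoc (G := X) (g t) (h t) (k t)). Qed.

Lemma BUC_plus_zero_r (g : BUC) : BUC_plus g BUC_zero = g.
Proof. apply BUC_ext; intros t. exact (plus_zero_r (G := X) (g t)). Qed.

Lemma BUC_plus_opp_r (g : BUC) : BUC_plus g (BUC_opp g) = BUC_zero.
Proof. apply BUC_ext; intros t. exact (plus_opp_r (G := X) (g t)). Qed.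

Definition BUC_AbelianMonoid_mixin :=
  AbelianMonoid.Mixin BUC BUC_plus BUC_zero BUC_plus_comm BUC_plus_assoc
    BUC_plus_zero_r.

Canonical BUC_AbelianMonoid :=
  AbelianMonoid.Pack BUC BUC_AbelianMonoid_mixin BUC.

Definition BUC_AbelianGroup_mixin :=
  AbelianGroup.Mixin BUC_AbelianMonoid BUC_opp BUC_plus_opp_r.

Canonical BUC_AbelianGroup :=
  AbelianGroup.Pack BUC
    (AbelianGroup.Class BUC BUC_AbelianMonoid_mixin BUC_AbelianGroup_mixin) BUC.

Lemma BUC_scal_assoc (c d : C) (g : BUC) :
  BUC_scal c (BUC_scal d g) = BUC_scal (mult c d) g.
Proof. apply BUC_ext; intros t. exact (scal_assoc c d (g t)). Qed.

Lemma BUC_scal_one (g : BUC) : BUC_scal one g = g.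
Proof. apply BUC_ext; intros t. exact (scal_one (g t)). Qed.

Lemma BUC_scal_distr_l (c : C) (g h : BUC) :
  BUC_scal c (plus g h) = plus (BUC_scal c g) (BUC_scal c h).
Proof. apply BUC_ext; intros t. exact (scal_distr_l c (g t) (h t)). Qed.

Lemma BUC_scal_distr_r (c d : C) (g : BUC) :
  BUC_scal (plus c d) g = plus (BUC_scal c g) (BUC_scal d g).
Proof. apply BUC_ext; intros t. exact (scal_distr_r c d (g t)). Qed.

Definition BUC_ModuleSpace_mixin :=
  ModuleSpace.Mixin C_Ring BUC_AbelianGroup BUC_scal BUC_scal_assoc BUC_scal_one
    BUC_scal_distr_l BUC_scal_distr_r.

Canonical BUC_ModuleSpace :=
  ModuleSpace.Pack C_Ring BUC
    (ModuleSpace.Class C_Ring BUC (AbelianGroup.class BUC_AbelianGroup)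
       BUC_ModuleSpace_mixin) BUC.

Definition sup_norm (g : BUC) : R :=
  real (Lub_Rbar (fun r : R => exists t : R, r = norm (g t))).

Lemma sup_norm_ge (g : BUC) (t : R) : norm (g t) <= sup_norm g.
Proof.
  destruct (BUC_bounded g) as [M HM]. unfold sup_norm.
  destruct (Lub_Rbar_correct (fun r => exists t, r = norm (g t))) as [H1 H2].
  assert (A := H1 _ (ex_intro _ t eq_refl)).
  assert (B : Rbar_le (Lub_Rbar (fun r => exists t, r = norm (g t))) M).
  { apply H2. intros r [s ->]. apply HM. }
  destruct (Lub_Rbar _); simpl in *; easy.
Qed.

Lemma sup_norm_le (g : BUC) (M : R) :
  (forall t, norm (g t) <= M) -> sup_norm g <= M.
Proof.
  intros HM. unfold sup_norm.
  destruct (Lub_Rbar_correct (fun r => exists t, r = norm (g t))) as [H1 H2].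
  assert (A := H1 _ (ex_intro _ 0 eq_refl)).
  assert (B : Rbar_le (Lub_Rbar (fun r => exists t, r = norm (g t))) M).
  { apply H2. intros r [s ->]. apply HM. }
  destruct (Lub_Rbar _); simpl in *; easy.
Qed.

Lemma sup_norm_triangle (g h : BUC) :
  sup_norm (plus g h) <= sup_norm g + sup_norm h.
Proof.
  apply sup_norm_le. intros t.
  eapply Rle_trans; [apply (norm_triangle (V := X) (g t) (h t))|].
  apply Rplus_le_compat; apply sup_norm_ge.
Qed.

Lemma sup_norm_scal (c : C) (g : BUC) :
  sup_norm (scal c g) <= abs c * sup_norm g.
Proof.
  apply sup_norm_le. intros t.
  eapply Rle_trans; [apply (norm_scal (V := X) c (g t))|].
  apply Rmult_le_compat_l; [apply abs_ge_0 | apply sup_norm_ge].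
Qed.

Lemma sup_norm_eq_zero (g : BUC) : sup_norm g = 0 -> g = zero.
Proof.
  intros H. apply BUC_ext. intros t. apply (norm_eq_zero (V := X)).
  apply Rle_antisym; [rewrite <- H; apply sup_norm_ge | apply (norm_ge_0 (V := X))].
Qed.

Definition BUC_ball (g : BUC) (eps : R) (h : BUC) : Prop :=
  sup_norm (minus h g) < eps.

Lemma BUC_ball_center (g : BUC) (eps : posreal) : BUC_ball g eps g.
Proof.
  unfold BUC_ball. rewrite minus_eq_zero.
  apply Rle_lt_trans with 0; [|apply cond_pos].
  apply sup_norm_le. intros t. apply Req_le, (norm_zero (V := X)).
Qed.

Lemma BUC_ball_sym (g h : BUC) (eps : R) : BUC_ball g eps h -> BUC_ball h eps g.
Proof.
  unfold BUC_ball. intros H. eapply Rle_lt_trans; [|exact H].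
  apply sup_norm_le. intros t.
  apply Rle_trans with (norm (minus h g t)); [|apply sup_norm_ge].
  apply Req_le. rewrite <- (norm_opp (V := X)). f_equal.
  exact (opp_minus (g t) (h t)).
Qed.

Lemma BUC_ball_triangle (g h k : BUC) (e1 e2 : R) :
  BUC_ball g e1 h -> BUC_ball h e2 k -> BUC_ball g (e1 + e2) k.
Proof.
  unfold BUC_ball. intros H1 H2.
  rewrite (minus_trans h k g).
  eapply Rle_lt_trans; [apply sup_norm_triangle|]. lra.
Qed.

Definition BUC_UniformSpace_mixin :=
  UniformSpace.Mixin BUC BUC_zero BUC_ball BUC_ball_center BUC_ball_sym
    BUC_ball_triangle.

Canonical BUC_UniformSpace :=
  UniformSpace.Pack BUC BUC_UniformSpace_mixin BUC.

Canonical BUC_NormedModuleAux :=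
  NormedModuleAux.Pack C_AbsRing BUC
    (NormedModuleAux.Class C_AbsRing BUC
       (ModuleSpace.class C_Ring BUC_ModuleSpace) BUC_UniformSpace_mixin) BUC.

Lemma BUC_norm_compat1 (g h : BUC) (eps : R) :
  sup_norm (minus h g) < eps -> ball g eps h.
Proof. exact (fun H => H). Qed.

Lemma BUC_norm_compat2 (g h : BUC) (eps : posreal) :
  ball g eps h -> sup_norm (minus h g) < 1 * eps.
Proof. rewrite Rmult_1_l. exact (fun H => H). Qed.

Definition BUC_NormedModule_mixin :=
  NormedModule.Mixin C_AbsRing BUC_NormedModuleAux sup_norm 1
    sup_norm_triangle sup_norm_scal BUC_norm_compat1 BUC_norm_compat2
    sup_norm_eq_zero.

Canonical BUC_NormedModule :=
  NormedModule.Pack C_AbsRing BUC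
    (NormedModule.Class C_AbsRing BUC
       (NormedModuleAux.class C_AbsRing BUC_NormedModuleAux)
       BUC_NormedModule_mixin) BUC.

Lemma translate_bounded (t : R) (g : BUC) : bounded_fct (fun s => g (t + s)).
Proof. destruct (BUC_bounded g) as [M HM]. exists M. intros s. apply HM. Qed.

Lemma translate_unifcont (t : R) (g : BUC) :
  uniformly_continuous (fun s => g (t + s)).
Proof.
  intros eps. destruct (BUC_unifcont g eps) as [d Hd]. exists d.
  intros r s Hrs. apply Hd. now replace (t + r - (t + s)) with (r - s) by ring.
Qed.

Definition translate (t : R) (g : BUC) : BUC :=
  mk_BUC _ (translate_bounded t g) (translate_unifcont t g).

Definition autonomous (B : BUC -> BUC) : Prop :=
  forall (t : R) (g : BUC), B (translate t g) = translate t (B g).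

(* Bohr's definition: the eps-almost periods are relatively dense. *)
Definition almost_periodic (g : R -> X) : Prop :=
  (forall t : R, continuous g t) /\
  forall eps : posreal, exists l : R, 0 < l /\
    forall a : R, exists tau : R, a <= tau <= a + l /\
      forall t : R, norm (minus (g (t + tau)) (g t)) <= eps.

Record AP : Type := mk_AP {
  AP_fct : R -> X;
  AP_almost_periodic : almost_periodic AP_fct }.

Lemma almost_periodic_bounded (g : R -> X) :
  almost_periodic g -> bounded_fct g.
Proof.
  intros [Cg Hg].
  destruct (Hg (mkposreal 1 Rlt_0_1)) as [l [Hl Hp]].
  destruct (bounded_continuity g 0 l (fun x _ => Cg x)) as [M HM].
  exists (M + 1). intros t.
  destruct (Hp (- t)) as [tau [Htau Hn]].
  specialize (Hn t); simpl in Hn.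
  assert (Hb := HM (t + tau) ltac:(lra)).
  assert (E : g t = minus (g (t + tau)) (minus (g (t + tau)) (g t))).
  { unfold minus. rewrite (opp_plus (G := X)), (opp_opp (G := X)),
      (plus_assoc (G := X)), (plus_opp_r (G := X)).
    symmetry; apply (plus_zero_l (G := X)). }
  rewrite E. unfold minus at 1.
  eapply Rle_trans; [apply (norm_triangle (V := X))|]. rewrite (norm_opp (V := X)). lra.
Qed.

Lemma almost_periodic_unifcont (g : R -> X) :
  almost_periodic g -> uniformly_continuous g.
Proof.
  intros [Cg Hg] eps.
  assert (He : 0 < eps / 4) by (generalize (cond_pos eps); lra).
  destruct (Hg (mkposreal _ He)) as [l [Hl Hp]].
  destruct (unifcont_normed_1d g (-1) (l + 1) (fun x _ => Cg x) (mkposreal _ He))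
    as [d Hd].
  assert (Hm : 0 < Rmin d 1) by (apply Rmin_pos; [apply cond_pos | lra]).
  exists (mkposreal _ Hm). simpl. intros s t Hst.
  destruct (Hp (- t)) as [tau [Htau Hn]]. simpl in Hn.
  assert (A1 := Hn s). assert (A2 := Hn t).
  assert (Hd1 := Rlt_le_trans _ _ _ Hst (Rmin_l _ _)).
  assert (Hd2 := Rlt_le_trans _ _ _ Hst (Rmin_r _ _)).
  apply Rabs_def2 in Hd2.
  assert (A3 : norm (minus (g (s + tau)) (g (t + tau))) < eps / 4).
  { apply (Hd (t + tau) (s + tau)); try lra.
    change (Rabs (s + tau - (t + tau)) < d).
    now replace (s + tau - (t + tau)) with (s - t) by ring. }
  rewrite (minus_trans (G := X) (g (s + tau)) (g s) (g t)).
  rewrite (minus_trans (G := X) (g (t + tau)) (g (s + tau)) (g t)).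
  eapply Rle_lt_trans; [apply (norm_triangle (V := X))|].
  rewrite <- (opp_minus (G := X) (g (s + tau)) (g s)), (norm_opp (V := X)).
  eapply Rle_lt_trans; [apply Rplus_le_compat_l, (norm_triangle (V := X))|].
  generalize (cond_pos eps); lra.
Qed.

Definition AP_BUC (g : AP) : BUC :=
  mk_BUC (AP_fct g)
    (almost_periodic_bounded _ (AP_almost_periodic g))
    (almost_periodic_unifcont _ (AP_almost_periodic g)).

Coercion AP_BUC : AP >-> BUC.

Definition cis (theta : R) : C := (cos theta, sin theta).

(* [lim] is the limit operator of the complete space [X]: it returns the limit
   of every convergent filter, and the mean converges when [g] is almost
   periodic. *)
Definition bohr_coef (lambda : R) (g : AP) : X :=
  lim (filtermap
    (fun T : R =>
       scal (RtoC (/ (2 * T)))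
         (integral (fun t : R => scal (cis (- (lambda * t))) (g t)) (- T) T))
    (Rbar_locally p_infty)).

Definition bohr_spectrum (g : AP) (lambda : R) : Prop :=
  bohr_coef lambda g <> zero.

End BUC.

Arguments translate {X} t g.
Arguments autonomous {X} B.
Arguments almost_periodic {X} g.
Arguments bohr_coef {X} lambda g.
Arguments bohr_spectrum {X} g lambda.

(* An operator [T] is given by its graph: [T x y] reads
   "x belongs to D(T) and T x = y". *)
Definition operator (Y : NormedModule C_AbsRing) : Type := Y -> Y -> Prop.

Record linear_operator {Y : NormedModule C_AbsRing} (T : operator Y) : Prop := {
  operator_functional : forall x y z : Y, T x y -> T x z -> y = z;
  operator_zero : T zero zero;
  operator_plus : forall x1 y1 x2 y2 : Y,
    T x1 y1 -> T x2 y2 -> T (plus x1 x2) (plus y1 y2);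
  operator_scal : forall (c : C) (x y : Y), T x y -> T (scal c x) (scal c y) }.

Definition closed_operator {Y : NormedModule C_AbsRing} (T : operator Y) : Prop :=
  closed (fun p : Y * Y => T (fst p) (snd p)).

(* [T + B] with domain D(T), for an everywhere defined [B]. *)
Definition operator_add {Y : NormedModule C_AbsRing}
  (T : operator Y) (B : Y -> Y) : operator Y :=
  fun x y => exists z : Y, T x z /\ y = plus z (B x).

(* [Res] is the bounded inverse of [lambda - T : D(T) -> Y]. *)
Definition resolvent_set {Y : NormedModule C_AbsRing} (T : operator Y)
  (lambda : C) : Prop :=
  exists Res : Y -> Y, is_linear Res /\
    forall x y : Y,
      Res y = x <-> exists z : Y, T x z /\ minus (scal lambda x) z = y.

Definition spectrum {Y : NormedModule C_AbsRing} (T : operator Y)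
  (lambda : C) : Prop := ~ resolvent_set T lambda.

Definition sigma_i {Y : NormedModule C_AbsRing} (T : operator Y)
  (xi : R) : Prop := spectrum T (Cmult Ci (RtoC xi)).

(* Since [h] ranges over BUC(R, X), the domain consists of the [g] such that
   g(t) is in D(A) for all t and A g(.) is again in BUC(R, X). *)
Definition pointwise_operator {X : complex_banach} (A : operator X) :
  operator (BUC_NormedModule X) :=
  fun g h : BUC X => forall t : R, A (g t) (h t).

Section Solutions.

Context {X : complex_banach}.
Variables (A : operator X) (B : BUC X -> BUC X) (f u : BUC X).

Definition mild_solution : Prop :=
  forall t : R, exists y : X,
    A (integral u 0 t) y /\
    minus (u t) (u 0) = plus y (integral (fun s => plus (B u s) (f s)) 0 t).

Definition classical_solution : Prop :=
  exists du : BUC X, forall t : R,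
    is_time_derive u t (du t) /\
    exists y : X, A (u t) y /\ du t = plus (plus y (B u t)) (f t).

End Solutions.

Definition strong_mild_solution {X : complex_banach} (A : operator X)
  (B : BUC X -> BUC X) (f u : BUC X) : Prop :=
  exists fn un : nat -> BUC X,
    (forall n : nat, classical_solution A B (fn n) (un n)) /\
    filterlim un eventually (locally u) /\
    filterlim fn eventually (locally f).

(* Main.v *)
(* For [g] almost periodic the means of [e^(-i lambda t) g(t+s)] converge to
   [e^(i lambda s) a(lambda, g)] uniformly in [s].  As [B] is bounded and commutes
   with translations, it commutes with these means, so the mean of
   [e^(-i lambda t) (B u)(t)] is the value at [0] of [B] applied to the wave
   [e^(i lambda .) a(lambda, u)].  Integrating the equation of the approximating
   classical solutions against [e^(-i lambda t)] and using twice that [A] is closed,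
   one gets for every strong mild solution [u] in AP
     [A a(lambda, u) = i lambda a(lambda, u) - B(e^(i lambda .) a(lambda, u))(0)
                       - a(lambda, f)].
   Hence [a(lambda, u) = 0] implies [a(lambda, f) = 0].  If [a(lambda, f) = 0], then
   the wave [e^(i lambda .) a(lambda, u)] is in the kernel of
   [i lambda - (A + B)], so it vanishes unless [lambda] is one of the finitely many
   points of [sigma_i], and it solves the homogeneous equation.  Subtracting these
   finitely many waves from [u] gives [u_f]. *)
Require Import Defs.
From Stdlib Require Import Reals Lra Lia Classical_Prop ClassicalEpsilon Finite_sets.
From Coquelicot Require Import Coquelicot.

Local Open Scope R_scope.

(** * Abelian groups, closed relations and limits of vector-valued maps *)

Section Group.

Context {G : AbelianGroup}.

Lemma minus_zero_l (x : G) : minus zero x = opp x.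
Proof. unfold minus. apply plus_zero_l. Qed.

Lemma plus_minus_r (x y : G) : plus (minus x y) y = x.
Proof. unfold minus. now rewrite <- (plus_assoc (G := G)), (plus_opp_l (G := G)), (plus_zero_r (G := G)). Qed.

Lemma minus_plus_r (x y : G) : minus (plus x y) y = x.
Proof. unfold minus. now rewrite <- (plus_assoc (G := G)), (plus_opp_r (G := G)), (plus_zero_r (G := G)). Qed.

Lemma minus_eq_zero_eq (x y : G) : minus x y = zero -> x = y.
Proof. intros H. rewrite <- (plus_minus_r x y), H. apply plus_zero_l. Qed.

Lemma plus_plus_swap (a b c d : G) :
  plus (plus a b) (plus c d) = plus (plus a c) (plus b d).
Proof.
  rewrite <- !(plus_assoc (G := G)). f_equal.
  rewrite !(plus_assoc (G := G)). f_equal. apply plus_comm.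
Qed.

End Group.

(** This is the form in which closedness of [A] is used throughout: it carries a closed relation to
    the limit of Riemann sums, of approximating solutions and of means. *)
Lemma closed_filterlim_pair {U W : UniformSpace} {T : Type}
  (F : (T -> Prop) -> Prop) {FF : ProperFilter F} (D : U -> W -> Prop)
  (f : T -> U) (g : T -> W) (x : U) (y : W) :
  closed (fun p : U * W => D (fst p) (snd p)) ->
  filterlim f F (locally x) -> filterlim g F (locally y) ->
  F (fun t => D (f t) (g t)) -> D x y.
Proof.
  intros HD Hf Hg H.
  apply (closed_filterlim_loc (F := F) (fun t => (f t, g t))
           (fun p : U * W => D (fst p) (snd p)) (x, y)); [|exact H|exact HD].
  apply filterlim_locally. intros eps.
  apply filter_and.
  - now apply (proj1 (filterlim_locally f x)).
  - now apply (proj1 (filterlim_locally g y)).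
Qed.

Section Norms.

Context {X : complex_banach}.
Implicit Types x y z : X.

Lemma norm_plus_le x y : norm (plus x y) <= norm x + norm y.
Proof. apply (norm_triangle (V := X)). Qed.

Lemma norm_scal_le (c : C) x : norm (scal c x) <= Cmod c * norm x.
Proof. apply (norm_scal (V := X)). Qed.

Lemma norm_nonneg x : 0 <= norm x.
Proof. apply (norm_ge_0 (V := X)). Qed.

Lemma norm_minus_sym x y : norm (minus x y) = norm (minus y x).
Proof. rewrite <- (opp_minus (G := X)). apply (norm_opp (V := X)). Qed.

Lemma norm_minus_triangle y x z :
  norm (minus x z) <= norm (minus x y) + norm (minus y z).
Proof. rewrite (minus_trans (G := X) y x z). apply norm_plus_le. Qed.

Lemma norm_minus_le x y : norm (minus x y) <= norm x + norm y.
Proof.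
  unfold minus. eapply Rle_trans; [apply norm_plus_le|].
  apply Req_le. f_equal. apply (norm_opp (V := X)).
Qed.

Lemma norm_le_eq_zero x :
  (forall eps : R, 0 < eps -> norm x <= eps) -> x = zero.
Proof.
  intros H. apply (norm_eq_zero (V := X)), Rle_antisym; [|apply norm_nonneg].
  apply le_epsilon. intros e He. rewrite Rplus_0_l. now apply H.
Qed.

Lemma scal_comm (c d : C) x : scal c (scal d x) = scal d (scal c x).
Proof. rewrite !(scal_assoc (V := X)). f_equal. apply Cmult_comm. Qed.

Section Limits.

Context {T : Type} (F : (T -> Prop) -> Prop) {FF : Filter F}.
Implicit Types (f g : T -> X) (l m : X).

Lemma filterlim_of_norm f l :
  (forall eps : R, 0 < eps -> F (fun t => norm (minus (f t) l) < eps)) ->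
  filterlim f F (locally l).
Proof.
  intros H. apply (filterlim_locally_ball_norm (U := X)). intros eps.
  exact (H eps (cond_pos eps)).
Qed.

Lemma filterlim_plus_fct f g l m :
  filterlim f F (locally l) -> filterlim g F (locally m) ->
  filterlim (fun t => plus (f t) (g t)) F (locally (plus l m)).
Proof.
  intros Hf Hg. exact (filterlim_comp_2 _ _ _ Hf Hg (filterlim_plus (V := X) l m)).
Qed.

Lemma filterlim_minus_fct f g l m :
  filterlim f F (locally l) -> filterlim g F (locally m) ->
  filterlim (fun t => minus (f t) (g t)) F (locally (minus l m)).
Proof.
  intros Hf Hg. refine (filterlim_plus_fct _ _ _ _ Hf _).
  eapply filterlim_comp; [exact Hg|apply (filterlim_opp (V := X))].
Qed.

Lemma filterlim_scal_fct (c : C) f l :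
  filterlim f F (locally l) ->
  filterlim (fun t => scal c (f t)) F (locally (scal c l)).
Proof.
  intros Hf. eapply filterlim_comp; [exact Hf|apply (filterlim_scal_r (V := X))].
Qed.

End Limits.

End Norms.

(** * Riemann integrals of continuous functions with values in [X] *)

Section Integral.

Context {X : complex_banach}.
Implicit Types (g h : R -> X) (x y : X).

Definition continuous_fct (g : R -> X) : Prop := forall t, continuous g t.

Lemma ex_integral g (a b : R) :
  continuous_fct g -> @ex_RInt (realify X) g a b.
Proof. intros Hg. apply ex_RInt_continuous. intros z _. exact (Hg z). Qed.

Lemma integral_correct g (a b : R) :
  continuous_fct g -> @is_RInt (realify X) g a b (integral g a b).
Proof. intros Hg. now apply @RInt_correct, ex_integral. Qed.

Lemma integral_ext g h (a b : R) :
  (forall t, g t = h t) -> integral g a b = integral h a b.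
Proof. intros E. apply (RInt_ext (V := realify X)). intros t _. apply E. Qed.

Lemma integral_chasles g (a b c : R) : continuous_fct g ->
  plus (integral g a b) (integral g b c) = integral g a c.
Proof.
  intros Hg. apply (RInt_Chasles (V := realify X)); now apply ex_integral.
Qed.

Lemma integral_point g (a : R) : integral g a a = zero.
Proof. exact (RInt_point (V := realify X) a g). Qed.

Lemma integral_plus g h (a b : R) : continuous_fct g -> continuous_fct h ->
  integral (fun t => plus (g t) (h t)) a b
  = plus (integral g a b) (integral h a b).
Proof.
  intros Hg Hh. apply (RInt_plus (V := realify X)); now apply ex_integral.
Qed.

Lemma integral_minus g h (a b : R) : continuous_fct g -> continuous_fct h ->
  integral (fun t => minus (g t) (h t)) a b
  = minus (integral g a b) (integral h a b).
Proof.
  intros Hg Hh. apply (RInt_minus (V := realify X)); now apply ex_integral.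
Qed.

Lemma integral_const x (a b : R) :
  integral (fun _ => x) a b = scal (RtoC (b - a)) x.
Proof. exact (RInt_const (V := realify X) a b x). Qed.

Lemma integral_shift g (s a b : R) : continuous_fct g ->
  integral (fun t => g (t + s)) a b = integral g (a + s) (b + s).
Proof.
  intros Hg.
  replace (a + s) with (1 * a + s) by ring. replace (b + s) with (1 * b + s) by ring.
  unfold integral.
  rewrite <- (RInt_comp_lin (V := realify X)) by now apply (ex_integral g).
  apply (RInt_ext (V := realify X)). intros t _.
  rewrite Rmult_1_l. symmetry. exact (scal_one (V := realify X) (g (t + s))).
Qed.

Lemma integral_swap g (a b : R) : continuous_fct g ->
  integral g b a = opp (integral g a b).
Proof.
  intros Hg. symmetry.
  exact (opp_RInt_swap (V := realify X) g a b (ex_integral g a b Hg)).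
Qed.

Lemma norm_integral_le g (a b M : R) : continuous_fct g ->
  (forall t, Rmin a b <= t <= Rmax a b -> norm (g t) <= M) ->
  norm (integral g a b) <= M * Rabs (b - a).
Proof.
  intros Hg HM.
  assert (P : forall c d, c <= d -> (forall t, c <= t <= d -> norm (g t) <= M) ->
    norm (integral g c d) <= M * (d - c)).
  { intros c d Hcd H. rewrite Rmult_comm.
    apply (norm_RInt_le_const (V := realify X) g c d); [easy|exact H|].
    now apply integral_correct. }
  destruct (Rle_or_lt a b) as [Hab|Hab].
  - rewrite Rabs_pos_eq by lra. apply P; [lra|].
    intros t Ht. apply HM. now rewrite Rmin_left, Rmax_right by lra.
  - rewrite Rabs_left by lra. rewrite integral_swap, (norm_opp (V := X)) by easy.
    replace (- (b - a)) with (a - b) by ring. apply P; [lra|].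
    intros t Ht. apply HM. now rewrite Rmin_right, Rmax_left by lra.
Qed.

Lemma integral_derive g h (a b : R) :
  (forall t, is_time_derive g t (h t)) -> continuous_fct h ->
  integral h a b = minus (g b) (g a).
Proof.
  intros D Hh. apply (is_RInt_unique (V := realify X)).
  apply (is_RInt_derive (V := realify X)).
  - intros t _. apply D.
  - intros t _. apply Hh.
Qed.

(** Riemann sums of [g] and [h] over one tagged subdivision are related by [T], because [T] is
    stable under sums and real multiples; closedness passes this to the integrals. For [T := A] it
    moves a closed operator through the integral. *)
Lemma integral_closed_graph (T : X -> X -> Prop) g h (a b : R) :
  closed (fun p : X * X => T (fst p) (snd p)) ->
  T zero zero ->
  (forall x1 y1 x2 y2, T x1 y1 -> T x2 y2 -> T (plus x1 x2) (plus y1 y2)) ->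
  (forall (c : R) x y, T x y -> T (scal (RtoC c) x) (scal (RtoC c) y)) ->
  continuous_fct g -> continuous_fct h -> (forall t, T (g t) (h t)) ->
  T (integral g a b) (integral h a b).
Proof.
  intros HT T0 Tp Ts Hg Hh H.
  assert (Ig := integral_correct g a b Hg).
  assert (Ih := integral_correct h a b Hh).
  unfold is_RInt in Ig, Ih.
  refine (closed_filterlim_pair (FF := Riemann_fine_filter a b) (Riemann_fine a b)
            T _ _ _ _ HT Ig Ih _).
  (* The integral is the limit of Riemann sums multiplied by [sign (b - a)], which covers [b < a]; a
     real multiple reduces the claim to the bare sum. *)
  apply filter_forall. intros ptd. apply (Ts (sign (b - a))).
  apply SF_cons_ind with (s := ptd).
  - intros x. exact T0.
  - intros p s IH. rewrite !(Riemann_sum_cons (V := realify X)).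
    apply Tp; [apply (Ts (SF_h s - fst p)), H|exact IH].
Qed.

(** The integral lives in [realify X] and so commutes at first with real scalars only. The complex
    case follows because multiplication by [c] has a closed real-linear graph. *)
Lemma integral_scal (c : C) g (a b : R) : continuous_fct g ->
  integral (fun t => scal c (g t)) a b = scal c (integral g a b).
Proof.
  intros Hg. symmetry.
  apply (integral_closed_graph (fun x y => scal c x = y) g (fun t => scal c (g t))).
  - apply (closed_ext (fun p : X * X => minus (scal c (fst p)) (snd p) = zero)).
    + intros [x y]; simpl; split; [apply (minus_eq_zero_eq (G := X))|].
      intros <-. apply (minus_eq_zero (G := X)).
    (* If the norm exceeded [e] at [(x, y)], it would do so on a neighbourhood, where the equation
       would then fail, against [H]. *)
    + intros [x y] H. simpl. apply norm_le_eq_zero. intros e He.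
      apply Rnot_lt_le. intros Hlt. apply H.
      assert (L : filterlim (fun p : X * X => norm (minus (scal c (fst p)) (snd p)))
                    (locally (x, y)) (locally (norm (minus (scal c x) y)))).
      { eapply filterlim_comp; [|apply (filterlim_norm (V := X))].
        refine (filterlim_minus_fct _ _ _ _ _ _ _).
        - refine (filterlim_scal_fct _ _ _ _ _). exact (continuous_fst x y).
        - exact (continuous_snd x y). }
      eapply filter_imp; [|exact (L _ (open_gt e _ Hlt))].
      intros [x' y']; simpl. intros Hp E.
      assert (Z : norm (minus (scal c x') y') = 0)
        by (rewrite E; apply (norm_zero (V := X))).
      lra.
  - apply (scal_zero_r (V := X)).
  - intros x1 y1 x2 y2 <- <-. apply (scal_distr_l (V := X)).
  - intros d x y <-. apply scal_comm.
  - exact Hg.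
  - intros t. apply (continuous_scal (V := X) (fun _ => c)); [apply continuous_const|apply Hg].
  - easy.
Qed.

End Integral.

(** * The unimodular phases [cis] and modulation of functions by them *)

Lemma cis_0 : cis 0 = RtoC 1.
Proof. unfold cis. now rewrite cos_0, sin_0. Qed.

Lemma cis_plus (a b : R) : cis (a + b) = Cmult (cis a) (cis b).
Proof.
  unfold cis, Cmult; simpl. rewrite cos_plus, sin_plus. f_equal; ring.
Qed.

Lemma Cmod_cis (a : R) : Cmod (cis a) = 1.
Proof.
  unfold Cmod, cis; simpl. rewrite !Rmult_1_r, Rplus_comm.
  change (sqrt (Rsqr (sin a) + Rsqr (cos a)) = 1).
  rewrite sin2_cos2. apply sqrt_1.
Qed.

(** [C] carries two uniform structures, by modulus and by components, with the same neighbourhoods;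
    continuity is checked on the components. *)
Lemma continuous_cis (a : R) :
  continuous (U := AbsRing_UniformSpace C_AbsRing) cis a.
Proof.
  intros P HP. apply locally_C in HP. revert P HP.
  change (continuous (U := C_UniformSpace) cis a).
  apply (filterlim_locally cis). intros eps. apply filter_and.
  - apply (proj1 (filterlim_locally cos (cos a)) (continuous_cos a)).
  - apply (proj1 (filterlim_locally sin (sin a)) (continuous_sin a)).
Qed.

Section Twist.

Context {X : complex_banach}.
Implicit Types (g h : R -> X) (x y : X).

Lemma norm_scal_cis (a : R) x : norm (scal (cis a) x) = norm x.
Proof.
  apply Rle_antisym.
  - eapply Rle_trans; [apply norm_scal_le|].
    change (abs (cis a)) with (Cmod (cis a)). rewrite Cmod_cis. lra.
  - replace x with (scal (cis (- a)) (scal (cis a) x)) at 1.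
    + eapply Rle_trans; [apply norm_scal_le|].
      change (abs (cis (- a))) with (Cmod (cis (- a))). rewrite Cmod_cis. lra.
    + rewrite (scal_assoc (V := X)). change mult with Cmult.
      rewrite <- cis_plus, Rplus_opp_l, cis_0. apply (scal_one (V := X)).
Qed.

Lemma scal_cis_cis (a b : R) x :
  scal (cis a) (scal (cis b) x) = scal (cis (a + b)) x.
Proof. rewrite (scal_assoc (V := X)). now rewrite cis_plus. Qed.

Lemma scal_cis_0 x : scal (cis 0) x = x.
Proof. rewrite cis_0. apply (scal_one (V := X)). Qed.

(** The integrand of the Bohr coefficient. With [- lambda] and a constant function it also yields
    the wave of frequency [lambda]. *)
Definition twist (lambda : R) (g : R -> X) (t : R) : X :=
  scal (cis (- (lambda * t))) (g t).

Lemma continuous_cis_lin (lambda t : R) :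
  continuous (U := AbsRing_UniformSpace C_AbsRing)
    (fun t => cis (- (lambda * t))) t.
Proof.
  apply (continuous_comp (W := AbsRing_UniformSpace C_AbsRing) (fun t => - (lambda * t)) cis).
  - apply (continuous_opp (V := R_NormedModule) (fun t => lambda * t)).
    apply (continuous_scal_r (V := R_NormedModule) lambda (fun t => t)).
    apply continuous_id.
  - apply continuous_cis.
Qed.

Lemma continuous_twist (lambda : R) g :
  continuous_fct g -> continuous_fct (twist lambda g).
Proof.
  intros Hg t. unfold twist.
  apply (continuous_scal (K := C_AbsRing) (V := X)); [|apply Hg].
  apply continuous_cis_lin.
Qed.

Lemma norm_twist (lambda : R) g (t : R) : norm (twist lambda g t) = norm (g t).
Proof. apply norm_scal_cis. Qed.

(** Splits a complex factor into real factors, so that the product rule for real scalars applies to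
    the cosine and the sine separately. *)
Lemma scal_pair (a b : R) x :
  scal ((a, b) : C) x = plus (scal (RtoC a) x) (scal (RtoC b) (scal Ci x)).
Proof.
  rewrite (scal_assoc (V := X)), <- (scal_distr_r (V := X)). f_equal.
  unfold plus, mult, RtoC, Ci, Cmult; simpl. unfold Cplus; simpl. f_equal; ring.
Qed.

Lemma is_linear_scal_realify (c : C) :
  is_linear (U := realify X) (V := realify X) (fun x => scal c (x : X)).
Proof.
  split.
  - intros x y. apply (scal_distr_l (V := X)).
  - intros k x. change (scal c (scal (RtoC k) (x : X)) = scal (RtoC k) (scal c (x : X))).
    apply scal_comm.
  - exists (Cmod c + 1). split; [generalize (Cmod_ge_0 c); lra|].
    intros x. eapply Rle_trans; [apply (norm_scal_le c x)|].
    apply Rmult_le_compat_r; [apply norm_nonneg|].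
    change (abs c) with (Cmod c). lra.
Qed.

Lemma is_time_derive_scal (k : R -> R) g (t dk : R) x :
  is_derive k t dk -> is_time_derive g t x ->
  is_time_derive (fun s => scal (RtoC (k s)) (g s)) t
    (plus (scal (RtoC dk) (g t)) (scal (RtoC (k t)) x)).
Proof.
  intros Hk Hg.
  assert (H := filterdiff_scal_fct (V := realify X) t k g _ _ Rmult_comm Hk Hg).
  eapply filterdiff_ext_lin; [exact H|].
  intros s. simpl.
  change (plus (scal (RtoC (s * dk)) (g t)) (scal (RtoC (k t)) (scal (RtoC s) x))
    = scal (RtoC s) (plus (scal (RtoC dk) (g t)) (scal (RtoC (k t)) x))).
  rewrite (scal_distr_l (V := X)), !(scal_assoc (V := X)). f_equal; f_equal.
  - apply RtoC_mult.
  - apply Cmult_comm.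
Qed.

Lemma is_time_derive_twist (lambda : R) g (t : R) x :
  is_time_derive g t x ->
  is_time_derive (twist lambda g) t
    (minus (scal (cis (- (lambda * t))) x)
       (scal (Cmult Ci (RtoC lambda)) (twist lambda g t))).
Proof.
  intros Hg.
  (* Multiplication by [Ci] is bounded and real-linear, hence passes through the derivative. *)
  assert (Hi : is_time_derive (fun s => scal Ci (g s)) t (scal Ci x)).
  { assert (H := @filterdiff_comp' R_AbsRing (AbsRing_NormedModule R_AbsRing) (realify X) (realify X) g _ t _ _ Hg
                   (filterdiff_linear (U := realify X) (V := realify X) (F := locally (g t)) _ (is_linear_scal_realify Ci))).
    eapply filterdiff_ext_lin; [exact H|]. intros s.
    apply (linear_scal _ (is_linear_scal_realify Ci)). }
  assert (Hc : is_derive (fun s => cos (- (lambda * s))) t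
                 (lambda * sin (- (lambda * t)))).
  { auto_derive; [easy|ring]. }
  assert (Hs : is_derive (fun s => sin (- (lambda * s))) t
                 (- lambda * cos (- (lambda * t)))).
  { auto_derive; [easy|ring]. }
  assert (H := is_derive_plus (V := realify X) _ _ _ _ _
                 (is_time_derive_scal _ _ _ _ _ Hc Hg)
                 (is_time_derive_scal _ _ _ _ _ Hs Hi)).
  eapply is_derive_ext.
  - intros s. symmetry. apply scal_pair.
  - match type of H with is_derive _ _ ?l => match goal with |- is_derive _ _ ?r =>
      replace r with l; [exact H|] end end.
    unfold twist, cis.
    set (c := cos _). set (s := sin _).
    change (plus (plus (scal (RtoC (lambda * s)) (g t)) (scal (RtoC c) x))
       (plus (scal (RtoC (- lambda * c)) (scal Ci (g t))) (scal (RtoC s) (scal Ci x)))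
      = minus (scal ((c, s) : C) x)
       (scal (Cmult Ci (RtoC lambda)) (scal ((c, s) : C) (g t)))).
    rewrite !(scal_assoc (V := X)).
    unfold minus. rewrite <- (scal_opp_l (V := X)).
    rewrite (plus_plus_swap (G := X)), <- !(scal_distr_r (V := X)).
    rewrite (plus_comm (G := X)). f_equal; f_equal.
    + unfold plus, mult, RtoC, Ci; simpl. unfold Cplus, Cmult; simpl. f_equal; ring.
    + unfold plus, mult, opp, RtoC, Ci; simpl. unfold Cplus, Cmult, Copp; simpl.
      f_equal; ring.
Qed.

End Twist.

(** * The equation integrated against an exponential *)

Section Equation.

Context {X : complex_banach}.

Lemma BUC_continuous (g : BUC X) : continuous_fct g.
Proof.
  intros t. refine (filterlim_of_norm _ _ _ _). intros eps He.
  destruct (BUC_unifcont _ g (mkposreal eps He)) as [d Hd].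
  exists d. intros s Hs. exact (Hd s t Hs).
Qed.

Lemma is_linear_eval (t : R) :
  is_linear (U := BUC_NormedModule X) (V := X) (fun g : BUC X => g t).
Proof.
  split; [easy|easy|]. exists 1. split; [lra|]. intros g.
  rewrite Rmult_1_l. apply sup_norm_ge.
Qed.

Definition twisted_integral (lambda a b : R) (g : BUC X) : X :=
  integral (twist lambda g) a b.

Lemma continuous_twist_BUC (lambda : R) (g : BUC X) :
  continuous_fct (twist lambda g).
Proof. apply continuous_twist, BUC_continuous. Qed.

Lemma is_linear_twisted_integral (lambda a b : R) :
  is_linear (U := BUC_NormedModule X) (V := X) (twisted_integral lambda a b).
Proof.
  split.
  - intros g h.
    etransitivity; [|apply integral_plus; apply continuous_twist_BUC].
    apply integral_ext. intros t. apply (scal_distr_l (V := X)).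
  - intros c g.
    etransitivity; [|apply integral_scal, continuous_twist_BUC].
    apply integral_ext. intros t. apply scal_comm.
  - exists (Rabs (b - a) + 1). split; [generalize (Rabs_pos (b - a)); lra|].
    intros g. assert (H : norm (twisted_integral lambda a b g)
                       <= sup_norm X g * Rabs (b - a)).
    { apply norm_integral_le; [apply continuous_twist_BUC|].
      intros t _. rewrite norm_twist. apply sup_norm_ge. }
    change (norm g) with (sup_norm X g).
    assert (H0 := norm_ge_0 (V := BUC_NormedModule X) g).
    change (norm g) with (sup_norm X g) in H0. nra.
Qed.

Variables (A : operator X) (B : BUC X -> BUC X).
Hypotheses (hA : linear_operator A) (hAcl : closed_operator A)
  (hB : is_linear B).

(** The integral of [cis (- (lambda * t))] times [u' - B u - f], with [u'] removed by parts: it is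
    continuous in [u] and [f] for the sup-norm and makes sense without a derivative. *)
Definition twisted_rhs (lambda a b : R) (f u : BUC X) : X :=
  minus
    (plus (minus (twist lambda u b) (twist lambda u a))
       (scal (Cmult Ci (RtoC lambda)) (twisted_integral lambda a b u)))
    (plus (twisted_integral lambda a b (B u)) (twisted_integral lambda a b f)).

(** Multiply the equation by the phase, integrate, and take the closed operator [A] out of the
    integral. *)
Lemma classical_twisted_integral (f u : BUC X) (lambda a b : R) :
  classical_solution A B f u ->
  A (twisted_integral lambda a b u) (twisted_rhs lambda a b f u).
Proof.
  intros [du Hu].
  (* Integration by parts: [twist lambda u] has derivative [twist lambda du] minus [i lambda] times
     itself. *)
  assert (D : twisted_integral lambda a b du
    = plus (minus (twist lambda u b) (twist lambda u a))
       (scal (Cmult Ci (RtoC lambda)) (twisted_integral lambda a b u))).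
  { unfold twisted_integral.
    rewrite <- integral_scal by apply continuous_twist_BUC.
    assert (Hc : continuous_fct
      (fun t => scal (Cmult Ci (RtoC lambda)) (twist lambda u t))).
    { intros t. apply (continuous_scal (K := C_AbsRing) (V := X) (fun _ => _));
        [apply continuous_const|apply continuous_twist_BUC]. }
    rewrite <- (integral_derive (twist lambda u) (fun t => minus (twist lambda du t)
      (scal (Cmult Ci (RtoC lambda)) (twist lambda u t)))).
    - rewrite integral_minus by (trivial; apply continuous_twist_BUC).
      symmetry. apply (plus_minus_r (G := X)).
    - intros t. apply is_time_derive_twist, Hu.
    - intros t. apply (continuous_minus (V := X)); [apply continuous_twist_BUC|apply Hc]. }
  unfold twisted_rhs. rewrite <- D. unfold twisted_integral.
  rewrite <- integral_plus by apply continuous_twist_BUC.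
  assert (Hc : continuous_fct
    (fun t => plus (twist lambda (B u) t) (twist lambda f t))).
  { intros t. apply (continuous_plus (V := X)); apply continuous_twist_BUC. }
  rewrite <- integral_minus by (trivial; apply continuous_twist_BUC).
  apply integral_closed_graph.
  - exact hAcl.
  - apply (operator_zero A hA).
  - apply (operator_plus A hA).
  - intros c x y. apply (operator_scal A hA).
  - apply continuous_twist_BUC.
  - intros t. apply (continuous_minus (V := X)); [apply continuous_twist_BUC|apply Hc].
  - intros t. destruct (Hu t) as [_ [y [Hy E]]].
    replace (minus _ _) with (scal (cis (- (lambda * t))) y).
    + now apply (operator_scal A hA).
    + unfold twist. rewrite E.
      rewrite <- (scal_distr_l (V := X)), <- (scal_minus_distr_l (V := X)).
      f_equal. rewrite <- (plus_assoc (G := X)). symmetry.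
      apply (minus_plus_r (G := X)).
Qed.

(** Every term of the classical identity is a bounded linear function of the solution or of the
    forcing term, so all of them converge along the approximating sequence and closedness of [A]
    gives the limit. *)
Lemma strong_mild_twisted_integral (f u : BUC X) (lambda a b : R) :
  strong_mild_solution A B f u ->
  A (twisted_integral lambda a b u) (twisted_rhs lambda a b f u).
Proof.
  intros [fn [un [Hn [Hu Hf]]]].
  assert (L : forall l : BUC X -> X, is_linear (U := BUC_NormedModule X) (V := X) l ->
    filterlim (fun n => l (un n)) eventually (locally (l u)) /\
    filterlim (fun n => l (fn n)) eventually (locally (l f))).
  { intros l Hl. split; (eapply filterlim_comp; [eassumption|]);
      exact (linear_cont (U := BUC_NormedModule X) (V := X) l _ Hl). }
  assert (LB := proj1 (L _ (is_linear_comp (V := BUC_NormedModule X) (W := X) B _ hB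
    (is_linear_twisted_integral lambda a b)))).
  assert (LI := L _ (is_linear_twisted_integral lambda a b)).
  refine (closed_filterlim_pair eventually A _ _ _ _ hAcl (proj1 LI) _
    (filter_forall _ (fun n => classical_twisted_integral (fn n) (un n) lambda a b (Hn n)))).
  unfold twisted_rhs.
  refine (filterlim_minus_fct _ _ _ _ _ _ _).
  - refine (filterlim_plus_fct _ _ _ _ _ _ _).
    + refine (filterlim_minus_fct _ _ _ _ _ _ _);
        refine (filterlim_scal_fct _ _ _ _ _);
        apply (L _ (is_linear_eval _)).
    + refine (filterlim_scal_fct _ _ _ _ _). apply LI.
  - refine (filterlim_plus_fct _ _ _ _ _ LB _). apply LI.
Qed.

Lemma twist_0 (g : R -> X) (t : R) : twist 0 g t = g t.
Proof. unfold twist. rewrite Rmult_0_l, Ropp_0. apply scal_cis_0. Qed.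

(** The frequency [0] on the interval from [0] to [t] turns the integrated identity into the mild
    equation. *)
Lemma strong_mild_is_mild (f u : BUC X) :
  strong_mild_solution A B f u -> mild_solution A B f u.
Proof.
  intros H t. exists (twisted_rhs 0 0 t f u).
  assert (E : forall g : BUC X, twisted_integral 0 0 t g = integral g 0 t).
  { intros g. apply integral_ext, twist_0. }
  split; [rewrite <- E; now apply strong_mild_twisted_integral|].
  unfold twisted_rhs. rewrite !E, !twist_0, Cmult_0_r.
  rewrite (integral_plus (B u) f) by apply BUC_continuous.
  rewrite (scal_zero_l (V := X)), (plus_zero_r (G := X)).
  symmetry. apply (plus_minus_r (G := X)).
Qed.

End Equation.

(** * Finite colourings of the line, a combinatorial form of total boundedness *)

Section Colouring.

(* Finitely many colours such that points of the same colour are related; for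
   [P a b := sup_t |g(t+a) - g(t+b)| <= eps] this says that the translates of
   [g] are totally bounded, which unlike relative density of periods passes
   obviously to pairs of functions. *)
Definition finitely_coloured (P : R -> R -> Prop) : Prop :=
  exists (n : nat) (c : R -> nat), (forall a, (c a < n)%nat) /\
    forall a b, c a = c b -> P a b.

Lemma finitely_coloured_impl (P Q : R -> R -> Prop) :
  (forall a b, P a b -> Q a b) -> finitely_coloured P -> finitely_coloured Q.
Proof. intros H [n [c [Hn Hc]]]. exists n, c. auto. Qed.

Lemma finitely_coloured_and (P Q : R -> R -> Prop) :
  finitely_coloured P -> finitely_coloured Q ->
  finitely_coloured (fun a b => P a b /\ Q a b).
Proof.
  intros [n [c [Hn Hc]]] [m [d [Hm Hd]]].
  (* The pair of colours is coded as remainder and quotient modulo [n], which is injective since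
     [c a < n]. *)
  exists (n * m)%nat, (fun a => c a + n * d a)%nat. split.
  - intros a. specialize (Hn a); specialize (Hm a). nia.
  - intros a b E. assert (c a = c b /\ d a = d b) as [E1 E2].
    { assert (Ha := Hn a). assert (Hb := Hn b).
      assert (d a = d b) by (destruct (Nat.lt_trichotomy (d a) (d b)) as [|[|]]; nia).
      split; nia. }
    auto.
Qed.

(** Colour [a] by the integer part of [h a / delta]: equal integer parts force values closer than
    [delta]. *)
Lemma finitely_coloured_bounded (h : R -> R) (l delta : R) :
  0 < delta -> (forall a, 0 <= h a <= l) ->
  finitely_coloured (fun a b => Rabs (h a - h b) < delta).
Proof.
  intros Hd Hh.
  assert (H0 : forall a, 0 <= h a / delta)
    by (intros a; apply Rdiv_le_0_compat; [apply Hh|lra]).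
  assert (Hl : 0 <= l / delta)
    by (apply Rdiv_le_0_compat; [generalize (Hh 0); lra|lra]).
  destruct (nfloor_ex _ Hl) as [n [_ Hn]].
  exists (S n), (fun a => proj1_sig (nfloor_ex _ (H0 a))). split.
  - intros a. destruct (nfloor_ex _ (H0 a)) as [k Hk]; simpl.
    apply INR_lt. rewrite S_INR. eapply Rle_lt_trans; [apply Hk|].
    eapply Rle_lt_trans; [|exact Hn].
    apply Rmult_le_compat_r; [left; now apply Rinv_0_lt_compat|apply Hh].
  - intros a b. destruct (nfloor_ex _ (H0 a)) as [k Hk].
    destruct (nfloor_ex _ (H0 b)) as [k' Hk']; simpl. intros <-.
    replace (h a - h b) with (delta * (h a / delta - h b / delta)) by (field; lra).
    rewrite Rabs_mult, (Rabs_pos_eq delta) by lra.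
    assert (Rabs (h a / delta - h b / delta) < 1) by (apply Rabs_def1; lra).
    nra.
Qed.

(** Choose a representative of each colour in use, all in [[-L, L]]. If [b] represents the colour of
    [a + L], then [tau = a + L - b] lies in [[a, a + 2 * L]], and [b + tau] and [b] have the same
    colour. *)
Lemma finitely_coloured_relatively_dense (P : R -> R -> Prop) :
  finitely_coloured P ->
  exists L, 0 < L /\
    forall a, exists tau, a <= tau <= a + L /\ exists b, P (b + tau) b.
Proof.
  intros [n [c [Hn Hc]]].
  assert (H : forall m, exists L, 0 < L /\
    forall a, (c a < m)%nat -> exists b, Rabs b <= L /\ c b = c a).
  { induction m as [|m [L [HL IH]]].
    - exists 1. split; [lra|]. intros a Ha. lia.
    (* Colour [m] enlarges the bound only if some point has it. *)
    - destruct (classic (exists b, c b = m)) as [[b Hb]|Hno].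
      + exists (L + Rabs b). assert (Hp := Rabs_pos b). split; [lra|].
        intros a Ha. destruct (Nat.eq_dec (c a) m) as [E|E].
        * exists b. split; [lra|congruence].
        * destruct (IH a ltac:(lia)) as [b' [Hb' E']]. exists b'. split; [lra|easy].
      + exists L. split; [easy|]. intros a Ha. apply IH.
        assert (c a <> m) by (intros E; apply Hno; now exists a). lia. }
  destruct (H n) as [L [HL HR]].
  exists (2 * L). split; [lra|]. intros a.
  destruct (HR (a + L) (Hn _)) as [b [Hb E]].
  apply Rabs_le_between in Hb.
  exists (a + L - b). split; [lra|]. exists b. apply Hc.
  rewrite E. f_equal. ring.
Qed.

End Colouring.

(** * Stability of almost periodicity under differences and modulation *)

Section AlmostPeriodic.

Context {X : complex_banach}.
Implicit Types g h : R -> X.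

Definition close_translates (g : R -> X) (eps a b : R) : Prop :=
  forall t, norm (minus (g (t + a)) (g (t + b))) <= eps.

(** An almost period moves every shift [a] to some [h a] in [[0, l]] at the cost [eps / 3]. By
    uniform continuity, shifts within [d] of each other give translates within [eps / 3], so a
    colouring of the bounded function [h] at scale [d] suffices. *)
Lemma almost_periodic_coloured g (eps : R) :
  almost_periodic g -> 0 < eps -> finitely_coloured (close_translates g eps).
Proof.
  intros Hg He.
  assert (He3 : 0 < eps / 3) by lra.
  destruct (almost_periodic_unifcont X g Hg (mkposreal _ He3)) as [d Hd].
  destruct (proj2 Hg (mkposreal _ He3)) as [l [Hl Hp]]. simpl in Hd, Hp.
  assert (Hb : forall a, exists b, 0 <= b <= l /\ close_translates g (eps / 3) b a).
  { intros a. destruct (Hp (- a)) as [tau [Ht H]].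
    exists (a + tau). split; [lra|]. intros t.
    rewrite <- Rplus_assoc. apply H. }
  set (h := fun a => proj1_sig
    (constructive_indefinite_description _ (Hb a))).
  assert (Hh : forall a, 0 <= h a <= l /\ close_translates g (eps / 3) (h a) a)
    by (intros a; exact (proj2_sig
      (constructive_indefinite_description _ (Hb a)))).
  eapply finitely_coloured_impl;
    [|apply (finitely_coloured_bounded h l d (cond_pos d) (fun a => proj1 (Hh a)))].
  intros a b Hab t. simpl in Hab.
  assert (E1 := proj2 (Hh a) t). assert (E2 := proj2 (Hh b) t).
  assert (E3 : norm (minus (g (t + h a)) (g (t + h b))) < eps / 3).
  { apply Hd. now replace (t + h a - (t + h b)) with (h a - h b) by ring. }
  eapply Rle_trans; [apply (norm_minus_triangle (g (t + h a)))|].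
  rewrite (norm_minus_sym (g (t + a))).
  eapply Rle_trans;
    [apply Rplus_le_compat_l, (norm_minus_triangle (g (t + h b)))|].
  lra.
Qed.

(** If the translates by [b + tau] and by [b] are close, then [tau] is an almost period, as
    replacing [t] by [t - b] shows. *)
Lemma almost_periodic_of_coloured g : continuous_fct g ->
  (forall eps, 0 < eps -> finitely_coloured (close_translates g eps)) ->
  almost_periodic g.
Proof.
  intros Cg H. split; [exact Cg|]. intros eps.
  destruct (finitely_coloured_relatively_dense _ (H eps (cond_pos eps)))
    as [L [HL HR]].
  exists L. split; [easy|]. intros a. destruct (HR a) as [tau [Ht [b Hb]]].
  exists tau. split; [easy|]. intros t. specialize (Hb (t - b)).
  replace (t - b + (b + tau)) with (t + tau) in Hb by ring.
  now replace (t - b + b) with t in Hb by ring.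
Qed.

Lemma almost_periodic_const (x : X) : almost_periodic (fun _ => x).
Proof.
  split; [intros t; apply continuous_const|]. intros eps. exists 1.
  split; [lra|]. intros a. exists a. split; [lra|]. intros _.
  apply Rle_trans with 0; [|apply Rlt_le, cond_pos].
  rewrite (minus_eq_zero (G := X)). apply Req_le, (norm_zero (V := X)).
Qed.

Lemma almost_periodic_minus g h : almost_periodic g -> almost_periodic h ->
  almost_periodic (fun t => minus (g t) (h t)).
Proof.
  intros Hg Hh. apply almost_periodic_of_coloured.
  - intros t. apply (continuous_minus (V := X)); [apply Hg|apply Hh].
  - intros eps He.
    apply finitely_coloured_impl with (2 := finitely_coloured_and _ _
      (almost_periodic_coloured g (eps / 2) Hg ltac:(lra))
      (almost_periodic_coloured h (eps / 2) Hh ltac:(lra))).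
    intros a b [H1 H2] t.
    replace (minus _ _) with (minus (minus (g (t + a)) (g (t + b)))
                                    (minus (h (t + a)) (h (t + b)))).
    + eapply Rle_trans; [apply norm_minus_le|].
      specialize (H1 t); specialize (H2 t); lra.
    + unfold minus. rewrite !(opp_plus (G := X)). apply (plus_plus_swap (G := X)).
Qed.

Lemma Cmod_pair_le (a b : R) : Cmod (a, b) <= Rabs a + Rabs b.
Proof.
  replace ((a, b) : C) with (Cplus (RtoC a) (Cmult Ci (RtoC b))).
  - eapply Rle_trans; [apply Cmod_triangle|].
    rewrite Cmod_mult, !Cmod_R.
    replace (Cmod Ci) with 1; [lra|].
    symmetry. transitivity (sqrt 1); [unfold Cmod, Ci; f_equal; simpl; ring|apply sqrt_1].
  - apply injective_projections; simpl; ring.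
Qed.

(** The factor [cis (- (lambda * t))] splits off the difference and has modulus one, so only the
    cosines and sines at [a] and [b] matter. *)
Lemma cis_coloured (lambda eps : R) : 0 < eps ->
  finitely_coloured (fun a b => forall t,
    Cmod (Cminus (cis (- (lambda * (t + a)))) (cis (- (lambda * (t + b))))) <= eps).
Proof.
  intros He.
  assert (Hc := fun x => COS_bound x). assert (Hs := fun x => SIN_bound x).
  (* Adding [1] moves the cosine and the sine into [[0, 2]], the range form that
     [finitely_coloured_bounded] requires. *)
  apply finitely_coloured_impl with (2 := finitely_coloured_and _ _
    (finitely_coloured_bounded (fun a => cos (- (lambda * a)) + 1) 2 (eps / 2)
       ltac:(lra) ltac:(intros a; specialize (Hc (- (lambda * a))); simpl; lra))
    (finitely_coloured_bounded (fun a => sin (- (lambda * a)) + 1) 2 (eps / 2)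
       ltac:(lra) ltac:(intros a; specialize (Hs (- (lambda * a))); simpl; lra))).
  intros a b [H1 H2] t; simpl in H1, H2.
  replace (Cminus _ _) with (Cmult (cis (- (lambda * t)))
    (Cminus (cis (- (lambda * a))) (cis (- (lambda * b))))).
  - rewrite Cmod_mult, Cmod_cis, Rmult_1_l.
    eapply Rle_trans; [apply (Cmod_pair_le
      (cos (- (lambda * a)) + - cos (- (lambda * b)))
      (sin (- (lambda * a)) + - sin (- (lambda * b))))|].
    replace (_ + 1 - (_ + 1)) with
      (cos (- (lambda * a)) + - cos (- (lambda * b))) in H1 by ring.
    replace (_ + 1 - (_ + 1)) with
      (sin (- (lambda * a)) + - sin (- (lambda * b))) in H2 by ring.
    lra.
  - replace (- (lambda * (t + a))) with (- (lambda * t) + - (lambda * a)) by ring.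
    replace (- (lambda * (t + b))) with (- (lambda * t) + - (lambda * b)) by ring.
    rewrite !cis_plus. ring.
Qed.

Lemma norm_scal_minus_scal_le (c d : C) (x y : X) :
  norm (minus (scal c x) (scal d y))
  <= Cmod c * norm (minus x y) + Cmod (Cminus c d) * norm y.
Proof.
  eapply Rle_trans; [apply (norm_minus_triangle (scal c y))|].
  apply Rplus_le_compat.
  - rewrite <- (scal_minus_distr_l (V := X)). apply norm_scal_le.
  - rewrite <- (scal_minus_distr_r (V := X)). apply norm_scal_le.
Qed.

Lemma almost_periodic_twist (lambda : R) g :
  almost_periodic g -> almost_periodic (twist lambda g).
Proof.
  intros Hg. apply almost_periodic_of_coloured;
    [apply continuous_twist; intros t; apply Hg|].
  intros eps He.
  destruct (almost_periodic_bounded X g Hg) as [M HM].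
  assert (M0 : 0 <= M) by (eapply Rle_trans; [|apply (HM 0)]; apply norm_nonneg).
  (* The divisor [M + 1] stays positive when the bound [M] is zero. *)
  assert (He' : 0 < eps / 2 / (M + 1)) by (apply Rdiv_lt_0_compat; lra).
  apply finitely_coloured_impl with (2 := finitely_coloured_and _ _
    (almost_periodic_coloured g (eps / 2) Hg ltac:(lra))
    (cis_coloured lambda _ He')).
  intros a b [H1 H2] t. specialize (H1 t). specialize (H2 t). unfold twist.
  eapply Rle_trans; [apply norm_scal_minus_scal_le|].
  rewrite Cmod_cis, Rmult_1_l.
  assert (Cmod (Cminus (cis (- (lambda * (t + a)))) (cis (- (lambda * (t + b)))))
          * norm (g (t + b)) <= eps / 2 / (M + 1) * (M + 1)).
  { apply Rmult_le_compat; [apply Cmod_ge_0|apply norm_nonneg|easy|].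
    specialize (HM (t + b)); lra. }
  replace (eps / 2 / (M + 1) * (M + 1)) with (eps / 2) in H by (field; lra).
  lra.
Qed.

End AlmostPeriodic.

(** * Existence of the mean of an almost periodic function, uniformly over translates *)

Section Mean.

Context {X : complex_banach}.

Lemma norm_scal_R_le (r : R) (x : X) : norm (scal (RtoC r) x) <= Rabs r * norm x.
Proof. rewrite <- Cmod_R. apply norm_scal_le. Qed.

Lemma minus_scal_R (r s : R) (x : X) :
  minus (scal (RtoC r) x) (scal (RtoC s) x) = scal (RtoC (r - s)) x.
Proof.
  rewrite RtoC_minus. symmetry.
  exact (scal_minus_distr_r (V := X) (RtoC r) (RtoC s) x).
Qed.

Lemma scal_R_assoc (r s : R) (x : X) :
  scal (RtoC r) (scal (RtoC s) x) = scal (RtoC (r * s)) x.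
Proof. rewrite RtoC_mult. exact (scal_assoc (V := X) (RtoC r) (RtoC s) x). Qed.

Section OneFunction.

Variables (h : R -> X) (hh : almost_periodic h) (M : R)
  (hM : forall t, norm (h t) <= M).

Let Ch : continuous_fct h.
Proof. intros t. apply hh. Qed.

Let M0 : 0 <= M.
Proof. exact (Rle_trans _ _ _ (norm_nonneg (h 0)) (hM 0)). Qed.

Lemma norm_integral_bounded (a b : R) : norm (integral h a b) <= M * Rabs (b - a).
Proof. now apply norm_integral_le. Qed.

(** An almost period moves the window [[s, s + T]] to one starting in [[0, l]], changing the
    integral by at most [eps * T]; what remains is a bounded end effect independent of [s] and
    [T]. *)
Lemma integral_window (eps : R) : 0 < eps -> exists K, 0 <= K /\
  forall s T, 0 <= T ->
    norm (minus (integral h s (s + T)) (integral h 0 T)) <= eps * T + K.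
Proof.
  intros He. destruct (proj2 hh (mkposreal eps He)) as [l [Hl Hp]]. simpl in Hp.
  exists (2 * M * l). split; [nra|]. intros s T HT.
  destruct (Hp (- s)) as [tau [Ht H]].
  assert (E : minus (integral h (s + tau) (s + T + tau)) (integral h s (s + T))
    = integral (fun t => minus (h (t + tau)) (h t)) s (s + T)).
  { rewrite integral_minus; [|intros t|exact Ch].
    - now rewrite integral_shift.
    - apply (continuous_comp (fun t => t + tau) h); [|apply Ch].
      apply (continuous_plus (V := R_NormedModule) (fun t => t) (fun _ => tau));
        [apply continuous_id|apply continuous_const]. }
  eapply Rle_trans;
    [apply (norm_minus_triangle (integral h (s + tau) (s + T + tau)))|].
  apply Rplus_le_compat.
  - rewrite norm_minus_sym, E.
    eapply Rle_trans; [apply norm_integral_le with (M := eps)|].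
    + intros t. apply (continuous_minus (V := X)); [|apply Ch].
      apply (continuous_comp (fun t => t + tau) h); [|apply Ch].
      apply (continuous_plus (V := R_NormedModule) (fun t => t) (fun _ => tau));
        [apply continuous_id|apply continuous_const].
    + intros t _. apply H.
    + replace (s + T - s) with T by ring. rewrite Rabs_pos_eq; lra.
  (* The integrals over [[r, T + r]] and [[0, T]] differ by those over [[T, T + r]] and [[0, r]],
     each at most [M * l] in norm. *)
  - set (r := s + tau). replace (s + T + tau) with (T + r) by (unfold r; ring).
    assert (Hr : 0 <= r <= l) by (unfold r; lra).
    replace (minus _ _) with (minus (integral h T (T + r)) (integral h 0 r)).
    + eapply Rle_trans; [apply norm_minus_le|].
      assert (H1 := norm_integral_bounded T (T + r)).
      assert (H2 := norm_integral_bounded 0 r).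
      replace (T + r - T) with r in H1 by ring. rewrite Rminus_0_r in H2.
      rewrite Rabs_pos_eq in H1, H2 by lra. nra.
    + rewrite <- (minus_plus_r (G := X) (integral h r (T + r)) (integral h 0 r)).
      rewrite (plus_comm (G := X) (integral h r (T + r))), integral_chasles by easy.
      rewrite <- (integral_chasles h 0 T (T + r)) by easy.
      unfold minus. rewrite (plus_comm (G := X) (integral h 0 T)).
      rewrite <- !(plus_assoc (G := X)). f_equal.
      rewrite (plus_comm (G := X) (opp (integral h 0 r))), (plus_assoc (G := X)).
      now rewrite (plus_opp_r (G := X)), (plus_zero_l (G := X)).
Qed.

(** Cut [[0, n T]] into [n] windows of length [T] and compare each with the first. *)
Lemma integral_multiple (eps K T : R) : 0 <= T ->
  (forall s, norm (minus (integral h s (s + T)) (integral h 0 T)) <= eps * T + K) ->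
  forall n, norm (minus (integral h 0 (INR n * T)) (scal (RtoC (INR n)) (integral h 0 T)))
    <= INR n * (eps * T + K).
Proof.
  intros HT HK n. induction n as [|n IH].
  - simpl. rewrite !Rmult_0_l, integral_point, (scal_zero_l (V := X)).
    rewrite (minus_eq_zero (G := X)). apply Req_le, (norm_zero (V := X)).
  - rewrite S_INR.
    replace ((INR n + 1) * T) with (INR n * T + T) by ring.
    rewrite <- (integral_chasles h 0 (INR n * T)) by easy.
    assert (E : scal (RtoC (INR n + 1)) (integral h 0 T)
      = plus (scal (RtoC (INR n)) (integral h 0 T)) (integral h 0 T)).
    { rewrite RtoC_plus.
      etransitivity; [apply (scal_distr_r (V := X) (RtoC (INR n)) (RtoC 1))|].
      f_equal. apply (scal_one (V := X)). }
    rewrite E.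
    rewrite (minus_plus_plus X).
    eapply Rle_trans; [apply norm_plus_le|].
    apply Rle_trans with (INR n * (eps * T + K) + (eps * T + K)); [|lra].
    apply Rplus_le_compat; [exact IH|apply HK].
Qed.

(** The mean over one long window [[0, T]] approximates all later ones. For [S] with integer part
    [n] of [S / T], the incomplete last window and the rounding of [S / T] to [n] cost [M * T] each,
    and the [n] full windows cost [n * (eps / 4 * T + K)]. *)
Lemma mean_cauchy (eps : R) : 0 < eps -> exists T0 x, 0 < T0 /\
  forall T, T0 <= T -> norm (minus (scal (RtoC (/ T)) (integral h 0 T)) x) <= eps.
Proof.
  intros He. assert (He4 : 0 < eps / 4) by lra.
  destruct (integral_window _ He4) as [K [HK HW]].
  (* Chosen so that [K <= eps / 4 * T]; the full windows then cost at most [eps / 2 * S]. *)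
  set (T := 4 * K / eps + 1).
  assert (HT : 0 < T).
  { assert (0 <= 4 * K / eps) by (apply Rdiv_le_0_compat; lra). unfold T; lra. }
  assert (HKT : K <= eps / 4 * T).
  { unfold T. replace (eps / 4 * (4 * K / eps + 1)) with (K + eps / 4) by (field; lra).
    lra. }
  assert (HTM : 0 <= 4 * M * T / eps) by (apply Rdiv_le_0_compat; nra).
  (* Beyond this threshold [M * T <= eps / 4 * S], so the two boundary errors together also cost at
     most [eps / 2 * S]. *)
  exists (4 * M * T / eps + 1), (scal (RtoC (/ T)) (integral h 0 T)).
  split; [lra|]. intros S HS.
  assert (S0 : 0 < S) by lra.
  assert (HMS : M * T <= eps / 4 * S).
  { apply Rle_trans with (eps / 4 * (4 * M * T / eps + 1)); [|nra].
    replace (eps / 4 * (4 * M * T / eps + 1)) with (M * T + eps / 4) by (field; lra).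
    lra. }
  assert (Hn0 : 0 <= S / T) by (apply Rdiv_le_0_compat; lra).
  destruct (nfloor_ex _ Hn0) as [n [Hn1 Hn2]].
  assert (Hn3 : INR n * T <= S).
  { replace S with (S / T * T) by (field; lra). nra. }
  assert (Hn4 : S < INR n * T + T).
  { replace S with (S / T * T) by (field; lra). nra. }
  assert (Q1 := norm_integral_bounded (INR n * T) S).
  rewrite Rabs_pos_eq in Q1 by lra.
  assert (Q2 := integral_multiple (eps / 4) K T ltac:(lra) (fun s => HW s T ltac:(lra)) n).
  assert (Q3 : norm (minus (scal (RtoC (INR n)) (integral h 0 T))
                       (scal (RtoC (S / T)) (integral h 0 T))) <= M * T).
  { rewrite minus_scal_R.
    eapply Rle_trans; [apply norm_scal_R_le|].
    assert (Q := norm_integral_bounded 0 T).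
    rewrite Rminus_0_r, (Rabs_pos_eq T) in Q by lra.
    assert (Rabs (INR n - S / T) <= 1) by (apply Rabs_le; lra).
    assert (0 <= Rabs (INR n - S / T)) by apply Rabs_pos.
    assert (0 <= norm (integral h 0 T)) by apply norm_nonneg. nra. }
  assert (Q4 : norm (minus (integral h 0 S) (scal (RtoC (S / T)) (integral h 0 T)))
    <= eps * S).
  { eapply Rle_trans; [apply (norm_minus_triangle (integral h 0 (INR n * T)))|].
    eapply Rle_trans; [apply Rplus_le_compat_l,
      (norm_minus_triangle (scal (RtoC (INR n)) (integral h 0 T)))|].
    assert (Q0 : norm (minus (integral h 0 S) (integral h 0 (INR n * T))) <= M * T).
    { rewrite <- (integral_chasles h 0 (INR n * T) S) by easy.
      rewrite (plus_comm (G := X) (integral h 0 _)), (minus_plus_r (G := X)).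
      eapply Rle_trans; [apply Q1|nra]. }
    apply Rle_trans with (M * T + (INR n * (eps / 4 * T + K) + M * T)).
    { apply Rplus_le_compat; [exact Q0|]. now apply Rplus_le_compat. }
    assert (INR n * (eps / 4 * T + K) <= INR n * (eps / 4 * T + eps / 4 * T)).
    { apply Rmult_le_compat_l; [apply pos_INR|lra]. }
    assert (eps / 2 * (INR n * T) <= eps / 2 * S) by (apply Rmult_le_compat_l; lra).
    lra. }
  replace (minus _ _) with (scal (RtoC (/ S)) (minus (integral h 0 S)
    (scal (RtoC (S / T)) (integral h 0 T)))).
  - eapply Rle_trans; [apply norm_scal_R_le|].
    rewrite Rabs_pos_eq by (left; now apply Rinv_0_lt_compat).
    apply Rle_trans with (/ S * (eps * S)).
    + apply Rmult_le_compat_l; [left; now apply Rinv_0_lt_compat|easy].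
    + right. field. lra.
  - rewrite (scal_minus_distr_l (V := X)). f_equal.
    rewrite scal_R_assoc. f_equal. f_equal. field. lra.
Qed.

(** The means over [[0, T]] converge by completeness. The window [[s - T, s + T]] is compared with
    [[0, 2 * T]] by [integral_window], whose error does not depend on [s]. *)
Lemma uniform_mean : exists x, forall eps, 0 < eps -> exists T0, 0 < T0 /\
  forall T s, T0 <= T ->
    norm (minus (scal (RtoC (/ (2 * T))) (integral h (s - T) (s + T))) x) <= eps.
Proof.
  assert (L : exists x, filterlim (fun T => scal (RtoC (/ T)) (integral h 0 T))
                (Rbar_locally p_infty) (locally x)).
  { apply (filterlim_locally_cauchy (U := X)). intros eps.
    assert (He : 0 < eps / 4) by (generalize (cond_pos eps); lra).
    destruct (mean_cauchy _ He) as [T0 [x [HT0 H]]].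
    exists (fun T => T0 < T). split; [now exists T0|]. intros S T HS HT.
    apply (norm_compat1 (V := X)).
    apply Rle_lt_trans with (eps / 4 + eps / 4); [|generalize (cond_pos eps); lra].
    eapply Rle_trans; [apply (norm_minus_triangle x)|].
    rewrite (norm_minus_sym x). apply Rplus_le_compat; apply H; lra. }
  destruct L as [x Hx]. exists x. intros eps He.
  assert (He3 : 0 < eps / 3) by lra.
  destruct (integral_window _ He3) as [K [HK HW]].
  destruct (proj1 (filterlim_locally_ball_norm (U := X) _ _) Hx (mkposreal _ He3))
    as [T1 HT1]. simpl in HT1.
  assert (HKe : 0 <= 3 * K / eps) by (apply Rdiv_le_0_compat; lra).
  (* The first term puts [2 * T] beyond [T1]; the second gives [K <= eps / 3 * (2 * T)]. *)
  exists (Rabs T1 + 3 * K / eps + 1).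
  split; [generalize (Rabs_pos T1); lra|]. intros T s HT.
  assert (A1 := Rabs_pos T1). assert (A2 := Rle_abs T1).
  assert (T0 : 0 < 2 * T) by lra.
  eapply Rle_trans; [apply (norm_minus_triangle (scal (RtoC (/ (2 * T)))
    (integral h 0 (2 * T))))|].
  assert (Q1 : norm (minus (scal (RtoC (/ (2 * T))) (integral h 0 (2 * T))) x) < eps / 3)
    by (apply (HT1 (2 * T)); lra).
  assert (Q2 := HW (s - T) (2 * T) ltac:(lra)).
  replace (s - T + 2 * T) with (s + T) in Q2 by ring.
  assert (Q3 : / (2 * T) * norm (minus (integral h (s - T) (s + T)) (integral h 0 (2 * T)))
     <= / (2 * T) * (2 * T * (eps * 2 / 3))).
  { apply Rmult_le_compat_l; [left; now apply Rinv_0_lt_compat|].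
    assert (K <= eps / 3 * (2 * T)).
    { apply Rle_trans with (eps / 3 * (2 * (3 * K / eps))); [|nra].
      replace (eps / 3 * (2 * (3 * K / eps))) with (2 * K) by (field; lra). lra. }
    lra. }
  replace (/ (2 * T) * (2 * T * (eps * 2 / 3))) with (eps * 2 / 3) in Q3 by (field; lra).
  apply Rle_trans with (eps * 2 / 3 + eps / 3); [|lra].
  apply Rplus_le_compat; [|now left].
  rewrite <- (scal_minus_distr_l (V := X)).
  eapply Rle_trans; [apply norm_scal_R_le|].
  rewrite Rabs_pos_eq by (left; now apply Rinv_0_lt_compat). exact Q3.
Qed.

End OneFunction.

End Mean.

(** * Bohr coefficients and waves *)

Section BohrCoefficient.

Context {X : complex_banach}.

Lemma lim_filterlim {T : Type} (F : (T -> Prop) -> Prop) {FF : ProperFilter F}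
  (f : T -> X) (x : X) :
  filterlim f F (locally x) -> lim (filtermap f F) = x.
Proof.
  intros H.
  assert (FP : ProperFilter (filtermap f F)) by now apply filtermap_proper_filter.
  assert (Hc : cauchy (filtermap f F)).
  { intros eps. exists x. apply H, locally_ball. }
  assert (Hl : filterlim f F (locally (lim (filtermap f F)))).
  { apply filterlim_locally. intros eps. exact (complete_cauchy _ FP Hc eps). }
  exact (filterlim_locally_unique (V := X) f _ _ Hl H).
Qed.

Lemma twisted_integral_translate (lambda s a b : R) (g : BUC X) :
  twisted_integral lambda a b (translate s g)
  = scal (cis (lambda * s)) (integral (twist lambda g) (s + a) (s + b)).
Proof.
  rewrite (Rplus_comm s a), (Rplus_comm s b),
    <- integral_shift by apply continuous_twist_BUC.
  rewrite <- integral_scal.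
  - apply integral_ext. intros t. unfold twist. rewrite scal_cis_cis.
    simpl. rewrite (Rplus_comm s t). f_equal. f_equal. ring.
  - intros t. apply (continuous_comp (fun t => t + s) (twist lambda g));
      [|apply continuous_twist_BUC].
    apply (continuous_plus (V := R_NormedModule) (fun t => t) (fun _ => s));
      [apply continuous_id|apply continuous_const].
Qed.

Lemma translate_0 (g : BUC X) : translate 0 g = g.
Proof. apply BUC_ext. intros t. simpl. now rewrite Rplus_0_l. Qed.

(** Uniformity in [s] says that the averages of the modulated translates converge in sup-norm to a
    wave, which is what a bounded operator on [BUC X] can be applied to. *)
Lemma bohr_coef_uniform (lambda : R) (g : AP X) (eps : R) : 0 < eps ->
  exists T0, 0 < T0 /\ forall T s, T0 <= T ->
    norm (minus
      (scal (RtoC (/ (2 * T))) (twisted_integral lambda (- T) T (translate s g)))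
      (scal (cis (lambda * s)) (bohr_coef lambda g))) <= eps.
Proof.
  intros He.
  destruct (almost_periodic_bounded X _ (AP_almost_periodic X g)) as [M HM].
  destruct (uniform_mean (twist lambda g)
    (almost_periodic_twist lambda _ (AP_almost_periodic X g)) M) as [x Hx].
  { intros t. rewrite norm_twist. apply HM. }
  assert (U : forall eps, 0 < eps -> exists T0, 0 < T0 /\ forall T s, T0 <= T ->
    norm (minus
      (scal (RtoC (/ (2 * T))) (twisted_integral lambda (- T) T (translate s g)))
      (scal (cis (lambda * s)) x)) <= eps).
  { intros e H. destruct (Hx e H) as [T0 [HT0 HT]]. exists T0.
    split; [easy|]. intros T s HTs. rewrite twisted_integral_translate.
    replace (scal (RtoC (/ (2 * T))) _) with (scal (cis (lambda * s))
      (scal (RtoC (/ (2 * T))) (integral (twist lambda g) (s - T) (s + T)))).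
    - rewrite <- (scal_minus_distr_l (V := X)), norm_scal_cis. now apply HT.
    - apply scal_comm. }
  replace (bohr_coef lambda g) with x; [now apply U|].
  symmetry. refine (lim_filterlim _ _ _ _). refine (filterlim_of_norm _ _ _ _). intros e H.
  destruct (U (e / 2) ltac:(lra)) as [T0 [HT0 HT]].
  exists T0. intros T HTT. apply Rle_lt_trans with (e / 2); [|lra].
  specialize (HT T 0 ltac:(lra)).
  rewrite translate_0, Rmult_0_r, scal_cis_0 in HT. exact HT.
Qed.

Lemma bohr_coef_translate_lim (lambda s : R) (g : AP X) :
  filterlim
    (fun T => scal (RtoC (/ (2 * T))) (twisted_integral lambda (- T) T (translate s g)))
    (Rbar_locally p_infty) (locally (scal (cis (lambda * s)) (bohr_coef lambda g))).
Proof.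
  refine (filterlim_of_norm _ _ _ _). intros e H.
  destruct (bohr_coef_uniform lambda g (e / 2) ltac:(lra)) as [T0 [HT0 HT]].
  exists T0. intros T HTT. apply Rle_lt_trans with (e / 2); [|lra].
  apply HT. lra.
Qed.

Lemma bohr_coef_lim (lambda : R) (g : AP X) :
  filterlim (fun T => scal (RtoC (/ (2 * T))) (twisted_integral lambda (- T) T g))
    (Rbar_locally p_infty) (locally (bohr_coef lambda g)).
Proof.
  assert (H := bohr_coef_translate_lim lambda 0 g).
  now rewrite translate_0, Rmult_0_r, scal_cis_0 in H.
Qed.

Lemma Rbar_locally_unique (f : R -> X) (x y : X) :
  filterlim f (Rbar_locally p_infty) (locally x) ->
  filterlim f (Rbar_locally p_infty) (locally y) -> x = y.
Proof. apply (filterlim_locally_unique (V := X)). Qed.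

Definition AP_minus (g h : AP X) : AP X :=
  mk_AP X _ (almost_periodic_minus _ _ (AP_almost_periodic X g) (AP_almost_periodic X h)).

Definition wave (lambda : R) (x : X) : AP X :=
  mk_AP X _ (almost_periodic_twist (- lambda) _ (almost_periodic_const x)).

Lemma waveE (lambda : R) (x : X) (t : R) :
  wave lambda x t = scal (cis (lambda * t)) x.
Proof. simpl. unfold twist. f_equal. f_equal. ring. Qed.

Lemma bohr_coef_minus (lambda : R) (g h : AP X) :
  bohr_coef lambda (AP_minus g h) = minus (bohr_coef lambda g) (bohr_coef lambda h).
Proof.
  eapply Rbar_locally_unique; [apply bohr_coef_lim|].
  eapply filterlim_ext; [|refine (filterlim_minus_fct _ _ _ _ _
    (bohr_coef_lim lambda g) (bohr_coef_lim lambda h))].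
  intros T. simpl. rewrite <- (scal_minus_distr_l (V := X)). f_equal.
  etransitivity; [symmetry; apply integral_minus; apply continuous_twist_BUC|].
  apply integral_ext. intros t. symmetry. apply (scal_minus_distr_l (V := X)).
Qed.

Lemma translate_wave (mu s : R) (x : X) :
  translate s (wave mu x) = scal (cis (mu * s)) (wave mu x : BUC X).
Proof.
  apply BUC_ext. intros t.
  change (wave mu x (s + t) = scal (cis (mu * s)) (wave mu x t)).
  rewrite !waveE, scal_cis_cis. f_equal. f_equal. ring.
Qed.

Lemma bohr_coef_wave (lambda : R) (x : X) : bohr_coef lambda (wave lambda x) = x.
Proof.
  eapply Rbar_locally_unique; [apply bohr_coef_lim|].
  refine (filterlim_of_norm _ _ _ _). intros e He. exists 0. intros T HT.
  replace (twisted_integral lambda (- T) T (wave lambda x)) with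
    (scal (RtoC (2 * T)) x).
  - rewrite scal_R_assoc, Rinv_l by lra.
    replace (scal (RtoC 1) x) with x by (symmetry; apply (scal_one (V := X))).
    rewrite (minus_eq_zero (G := X)).
    eapply Rle_lt_trans; [apply Req_le, (norm_zero (V := X))|easy].
  - replace (2 * T) with (T - - T) by ring. rewrite <- integral_const.
    apply integral_ext. intros t. unfold twist. rewrite waveE, scal_cis_cis.
    rewrite Rplus_opp_l. symmetry. apply scal_cis_0.
Qed.

Lemma bohr_coef_wave_ne (lambda mu : R) (x : X) :
  lambda <> mu -> bohr_coef lambda (wave mu x) = zero.
Proof.
  intros Hne. set (a := bohr_coef lambda (wave mu x)).
  (* Translating the wave by [s] multiplies its mean by both [e^(i mu s)] and
     [e^(i lambda s)]; at [s = PI / (lambda - mu)] these are opposite. *)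
  assert (E : forall s, scal (cis (mu * s)) a = scal (cis (lambda * s)) a).
  { intros s. eapply Rbar_locally_unique; [|apply bohr_coef_translate_lim].
    eapply filterlim_ext; [|exact (filterlim_scal_fct _ (cis (mu * s)) _ _
      (bohr_coef_lim lambda (wave mu x)))].
    intros T. rewrite translate_wave.
    replace (twisted_integral lambda (- T) T (scal _ _)) with
      (scal (cis (mu * s)) (twisted_integral lambda (- T) T (wave mu x)))
      by (symmetry; apply (linear_scal _ (is_linear_twisted_integral lambda (- T) T))).
    apply scal_comm. }
  specialize (E (PI / (lambda - mu))).
  replace (lambda * (PI / (lambda - mu))) with (mu * (PI / (lambda - mu)) + PI)
    in E by (field; lra).
  assert (E2 : a = scal (cis PI) a).
  { rewrite <- (scal_cis_0 a) at 1.
    rewrite <- (Rplus_opp_l (mu * (PI / (lambda - mu)))), <- scal_cis_cis, E.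
    rewrite scal_cis_cis. f_equal. f_equal. ring. }
  assert (E3 : scal (RtoC 2) a = zero).
  { replace (RtoC 2) with (Cplus (RtoC 1) (RtoC 1))
      by (apply injective_projections; simpl; ring).
    etransitivity; [apply (scal_distr_r (V := X) (RtoC 1) (RtoC 1))|].
    rewrite E2 at 2. rewrite (scal_assoc (V := X)).
    rewrite <- (scal_distr_r (V := X)).
    replace (plus _ _) with (@zero C_AbelianGroup);
      [apply (scal_zero_l (V := X))|].
    unfold cis. rewrite cos_PI, sin_PI.
    apply injective_projections; simpl; unfold zero, plus, mult; simpl; ring. }
  replace a with (scal (RtoC (/ 2 * 2)) a).
  - rewrite <- scal_R_assoc, E3. apply (scal_zero_r (V := X)).
  - rewrite Rinv_l by lra. apply (scal_one (V := X)).
Qed.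

End BohrCoefficient.

(** * Autonomous operators commute with Bohr means *)

Section Autonomous.

Context {X : complex_banach}.

Lemma slide_bounded (lambda a b : R) (g : BUC X) :
  bounded_fct X (fun s => twisted_integral lambda a b (translate s g)).
Proof.
  destruct (BUC_bounded X g) as [M HM]. exists (M * Rabs (b - a)). intros s.
  apply norm_integral_le; [apply continuous_twist_BUC|].
  intros t _. rewrite norm_twist. apply HM.
Qed.

Lemma slide_unifcont (lambda a b : R) (g : BUC X) :
  uniformly_continuous X (fun s => twisted_integral lambda a b (translate s g)).
Proof.
  intros eps. assert (Hp := Rabs_pos (b - a)).
  assert (He : 0 < eps / (Rabs (b - a) + 1))
    by (apply Rdiv_lt_0_compat; [apply cond_pos|lra]).
  destruct (BUC_unifcont X g (mkposreal _ He)) as [d Hd]. simpl in Hd.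
  exists d. intros s t Hst. unfold twisted_integral.
  rewrite <- integral_minus by apply continuous_twist_BUC.
  eapply Rle_lt_trans; [apply norm_integral_le with (M := eps / (Rabs (b - a) + 1))|].
  - intros r. apply (continuous_minus (V := X)); apply continuous_twist_BUC.
  - intros r _. unfold twist. rewrite <- (scal_minus_distr_l (V := X)), norm_scal_cis.
    apply Rlt_le, Hd. now replace (s + r - (t + r)) with (s - t) by ring.
  - apply Rmult_lt_reg_r with (Rabs (b - a) + 1); [lra|].
    replace (eps / (Rabs (b - a) + 1) * Rabs (b - a) * (Rabs (b - a) + 1))
      with (eps * Rabs (b - a)) by (field; lra).
    generalize (cond_pos eps); nra.
Qed.

(* The Bochner integral of [t |-> e^(-i lambda t) S(t) g] over [[a, b]]. *)
Definition slide (lambda a b : R) (g : BUC X) : BUC X :=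
  mk_BUC X _ (slide_bounded lambda a b g) (slide_unifcont lambda a b g).

(** The bound is uniform in [s]: the curve of modulated translates of [g] is continuous in sup-norm,
    hence [slide] is differentiable in its upper limit. *)
Lemma twist_equicontinuous (lambda t : R) (g : BUC X) (eps : R) : 0 < eps ->
  exists d : posreal, forall r s, Rabs (r - t) < d ->
    norm (minus (twist lambda (translate s g) r) (twist lambda (translate s g) t)) <= eps.
Proof.
  intros He. destruct (BUC_bounded X g) as [M HM].
  assert (M0 : 0 <= M) by exact (Rle_trans _ _ _ (norm_nonneg (g 0)) (HM 0)).
  assert (He2 : 0 < eps / 2) by lra.
  assert (He' : 0 < eps / 2 / (M + 1)) by (apply Rdiv_lt_0_compat; lra).
  destruct (BUC_unifcont X g (mkposreal _ He2)) as [d1 H1]. simpl in H1.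
  destruct (proj1 (filterlim_locally (U := AbsRing_UniformSpace C_AbsRing) _ _)
    (continuous_cis_lin lambda t) (mkposreal _ He')) as [d2 H2].
  assert (Hd : 0 < Rmin d1 d2) by (apply Rmin_pos; apply cond_pos).
  exists (mkposreal _ Hd). simpl. intros r s Hr. unfold twist.
  eapply Rle_trans; [apply norm_scal_minus_scal_le|].
  rewrite Cmod_cis, Rmult_1_l.
  assert (Q1 : norm (minus (translate s g r) (translate s g t)) < eps / 2).
  { apply H1. replace (s + r - (s + t)) with (r - t) by ring.
    eapply Rlt_le_trans; [exact Hr|apply Rmin_l]. }
  assert (Q2 : Cmod (Cminus (cis (- (lambda * r))) (cis (- (lambda * t))))
               < eps / 2 / (M + 1)).
  { apply (H2 r). eapply Rlt_le_trans; [exact Hr|apply Rmin_r]. }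
  assert (Q3 : Cmod (Cminus (cis (- (lambda * r))) (cis (- (lambda * t))))
          * norm (translate s g t) <= eps / 2 / (M + 1) * (M + 1)).
  { apply Rmult_le_compat; [apply Cmod_ge_0|apply norm_nonneg|lra|].
    specialize (HM (s + t)); simpl; lra. }
  replace (eps / 2 / (M + 1) * (M + 1)) with (eps / 2) in Q3 by (field; lra).
  apply Rle_trans with (eps / 2 + eps / 2); [|lra].
  apply Rplus_le_compat; [now left|exact Q3].
Qed.

Variable B : BUC X -> BUC X.
Hypotheses (hB : is_linear (U := BUC_NormedModule X) (V := BUC_NormedModule X) B)
  (hBaut : autonomous B).

Lemma autonomous_eval (t : R) (g : BUC X) : B (translate t g) 0 = B g t.
Proof. rewrite hBaut. simpl. now rewrite Rplus_0_r. Qed.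

Lemma is_linear_eval_B (t : R) :
  is_linear (U := BUC_NormedModule X) (V := X) (fun g => B g t).
Proof.
  exact (is_linear_comp (V := BUC_NormedModule X) (W := X) B _ hB (is_linear_eval t)).
Qed.

Lemma linear_minus_X (l : BUC X -> X) (g h : BUC X) :
  is_linear (U := BUC_NormedModule X) (V := X) l ->
  l (minus g h) = minus (l g) (l h).
Proof.
  intros Hl.
  assert (E : l (opp h) = opp (l h)).
  { transitivity (l (scal (opp one) h)).
    - f_equal. symmetry. apply (scal_opp_one (V := BUC_ModuleSpace X)).
    - etransitivity; [apply (linear_scal _ Hl)|apply (scal_opp_one (V := X))]. }
  etransitivity; [apply (linear_plus _ Hl g (opp h))|]. now rewrite E.
Qed.

(** As a function of the upper limit [t], [slide] has the sup-norm derivative [cis (- (lambda * t))]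
    times [translate t g]. The bounded functional [B _ 0] sends this to [twist lambda (B g) t]
    because [B] is autonomous, and integration from [a] to [b] gives the claim. *)
Lemma autonomous_slide (lambda a b : R) (g : BUC X) :
  B (slide lambda a b g) 0 = twisted_integral lambda a b (B g).
Proof.
  destruct (linear_norm _ (is_linear_eval_B 0)) as [K [HK Hn]].
  unfold twisted_integral.
  rewrite (integral_derive (fun t => B (slide lambda a t g) 0)).
  - replace (slide lambda a a g) with (@zero (BUC_NormedModule X)).
    + rewrite (linear_zero _ (is_linear_eval_B 0)). symmetry.
      apply (minus_zero_r (G := X)).
    + apply BUC_ext. intros s. symmetry. apply integral_point.
  - intros t. split; [apply is_linear_scal_l|].
    intros t' Ht'.
    assert (t = t') by now apply (is_filter_lim_locally_unique (V := R_NormedModule)).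
    subst t'. clear Ht'. intros eps.
    assert (He : 0 < eps / K) by (apply Rdiv_lt_0_compat; [apply cond_pos|easy]).
    destruct (twist_equicontinuous lambda t g _ He) as [d Hd].
    exists d. intros y Hy. change (Rabs (y - t) < d) in Hy.
    (* The remainder of the first-order expansion of [slide] at [t]; the factor [eps / K] in its
       bound absorbs the norm bound [K] of [B _ 0]. *)
    set (D := minus (minus (slide lambda a y g) (slide lambda a t g))
      (scal (RtoC (y - t)) (scal (cis (- (lambda * t))) (translate t g)))).
    assert (HD : sup_norm X D <= eps / K * Rabs (y - t)).
    { apply sup_norm_le. intros s.
      change (D s) with (minus (minus (integral (twist lambda (translate s g)) a y)
          (integral (twist lambda (translate s g)) a t))
        (scal (RtoC (y - t)) (scal (cis (- (lambda * t))) (g (t + s))))).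
      replace (g (t + s)) with (translate s g t) by (simpl; f_equal; ring).
      change (scal (cis (- (lambda * t))) (translate s g t))
        with (twist lambda (translate s g) t).
      rewrite <- integral_const.
      rewrite <- (integral_chasles _ a t y) by apply continuous_twist_BUC.
      rewrite (plus_comm (G := X) (integral _ a t)), (minus_plus_r (G := X)).
      rewrite <- integral_minus;
        [|apply continuous_twist_BUC|intros r; apply continuous_const].
      apply norm_integral_le.
      - intros r. apply (continuous_minus (V := X));
          [apply continuous_twist_BUC|apply continuous_const].
      - intros r Hr. apply Hd. eapply Rle_lt_trans; [|exact Hy].
        revert Hr. unfold Rmin, Rmax. destruct (Rle_dec t y); intros Hr;
          unfold Rabs; repeat destruct Rcase_abs; lra. }
    apply Rle_trans with (norm (B D 0)).
    + apply Req_le. change (norm (minus (minus (B (slide lambda a y g) 0)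
        (B (slide lambda a t g) 0)) (scal (RtoC (y - t)) (twist lambda (B g) t)))
        = norm (B D 0)). f_equal. unfold D.
      rewrite !(linear_minus_X (fun g => B g 0)) by apply is_linear_eval_B.
      f_equal. f_equal. symmetry.
      etransitivity; [apply (linear_scal _ (is_linear_eval_B 0))|]. f_equal.
      etransitivity; [apply (linear_scal _ (is_linear_eval_B 0))|].
      unfold twist. f_equal. apply autonomous_eval.
    + eapply Rle_trans; [apply Hn|].
      change (norm D) with (sup_norm X D). change (norm (minus y t)) with (Rabs (y - t)).
      apply Rle_trans with (K * (eps / K * Rabs (y - t))).
      * apply Rmult_le_compat_l; lra.
      * right. field. lra.
  - apply continuous_twist_BUC.
Qed.

(** Apply the bounded functional [B _ 0] to the sup-norm convergence of the averages
    [slide lambda (- T) T g / (2 * T)] to the wave. *)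
Lemma autonomous_mean (lambda : R) (g : AP X) :
  filterlim
    (fun T => scal (RtoC (/ (2 * T))) (twisted_integral lambda (- T) T (B g)))
    (Rbar_locally p_infty) (locally (B (wave lambda (bohr_coef lambda g)) 0)).
Proof.
  destruct (linear_norm _ (is_linear_eval_B 0)) as [K [HK Hn]].
  refine (filterlim_of_norm _ _ _ _). intros e He.
  assert (He' : 0 < e / (2 * K)) by (apply Rdiv_lt_0_compat; lra).
  destruct (bohr_coef_uniform lambda g _ He') as [T0 [_ HT]].
  exists T0. intros T HTT.
  set (D := minus (scal (RtoC (/ (2 * T))) (slide lambda (- T) T g))
              (wave lambda (bohr_coef lambda g) : BUC X)).
  match goal with |- norm ?x < _ => replace x with (B D 0) end.
  - apply Rle_lt_trans with (K * (e / (2 * K))).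
    + eapply Rle_trans; [apply Hn|]. apply Rmult_le_compat_l; [lra|].
      apply sup_norm_le. intros s.
      change (D s) with (minus (scal (RtoC (/ (2 * T)))
        (twisted_integral lambda (- T) T (translate s g)))
        (wave lambda (bohr_coef lambda g) s)).
      rewrite waveE. apply HT. lra.
    + replace (K * (e / (2 * K))) with (e / 2) by (field; lra). lra.
  - unfold D. rewrite (linear_minus_X (fun g => B g 0)) by apply is_linear_eval_B.
    f_equal. etransitivity; [apply (linear_scal _ (is_linear_eval_B 0))|].
    f_equal. apply autonomous_slide.
Qed.

(** A wave is an eigenvector of all translations, so its image under [B] is one as well, hence a
    wave of the same frequency. *)
Lemma autonomous_wave (lambda : R) (x : X) (t : R) :
  B (wave lambda x) t = scal (cis (lambda * t)) (B (wave lambda x) 0).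
Proof.
  rewrite <- autonomous_eval, translate_wave.
  apply (linear_scal _ (is_linear_eval_B 0)).
Qed.

End Autonomous.

(** * The equation for Bohr coefficients and the removal of spectral frequencies *)

Section Spectrum.

Context {X : complex_banach}.
Variables (A : operator X) (B : BUC X -> BUC X).
Hypotheses (hA : linear_operator A) (hAcl : closed_operator A)
  (hB : is_linear (U := BUC_NormedModule X) (V := BUC_NormedModule X) B)
  (hBaut : autonomous B).

Lemma operator_minus (x1 y1 x2 y2 : X) :
  A x1 y1 -> A x2 y2 -> A (minus x1 x2) (minus y1 y2).
Proof.
  intros H1 H2.
  assert (E : forall x y : X, plus x (scal (opp (one : C)) y) = minus x y)
    by (intros x y; exact (f_equal (plus x) (scal_opp_one (V := X) y))).
  rewrite <- !E. apply (operator_plus A hA); [easy|].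
  now apply (operator_scal A hA).
Qed.

(** Divide the integrated equation over [[-T, T]] by [2 * T], let [T] tend to infinity and use that
    [A] is closed; the boundary terms vanish since [u] is bounded. *)
Lemma bohr_coef_equation (f u : AP X) (lambda : R) :
  strong_mild_solution A B f u ->
  A (bohr_coef lambda u)
    (minus (scal (Cmult Ci (RtoC lambda)) (bohr_coef lambda u))
       (plus (B (wave lambda (bohr_coef lambda u)) 0) (bohr_coef lambda f))).
Proof.
  intros Hu.
  refine (closed_filterlim_pair (Rbar_locally p_infty) A _ _ _ _ hAcl
    (bohr_coef_lim lambda u) _ (filter_forall _ (fun T => operator_scal A hA
      (RtoC (/ (2 * T))) _ _
      (strong_mild_twisted_integral A B hA hAcl hB f u lambda (- T) T Hu)))).
  eapply filterlim_ext.
  { intros T. unfold twisted_rhs. symmetry.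
    etransitivity; [apply (scal_minus_distr_l (V := X))|].
    apply (f_equal2 (minus (G := X))); apply (scal_distr_l (V := X)). }
  refine (filterlim_minus_fct _ _ _ _ _ _ _).
  2: { refine (filterlim_plus_fct _ _ _ _ _ _ _); [now apply autonomous_mean|].
       apply bohr_coef_lim. }
  rewrite <- (plus_zero_l (G := X) (scal _ (bohr_coef lambda u))).
  refine (filterlim_plus_fct _ _ _ _ _ _ _).
  2: { eapply filterlim_ext; [|exact (filterlim_scal_fct _
         (Cmult Ci (RtoC lambda)) _ _ (bohr_coef_lim lambda u))].
       intros T. apply scal_comm. }
  (* The boundary terms have norm at most [2 * M / (2 * T)], which is below [e] once [T > M / e]. *)
  destruct (BUC_bounded X u) as [M HM].
  assert (M0 : 0 <= M) by exact (Rle_trans _ _ _ (norm_nonneg (u 0)) (HM 0)).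
  refine (filterlim_of_norm _ _ _ _). intros e He. exists (M / e + 1).
  assert (0 <= M / e) by (apply Rdiv_le_0_compat; lra).
  intros T HT. rewrite (minus_zero_r (G := X)).
  eapply Rle_lt_trans; [apply norm_scal_R_le|].
  rewrite Rabs_pos_eq by (left; apply Rinv_0_lt_compat; lra).
  apply Rmult_lt_reg_l with (2 * T); [lra|].
  rewrite <- Rmult_assoc, Rinv_r, Rmult_1_l by lra.
  apply Rle_lt_trans with (M + M).
  - eapply Rle_trans; [apply norm_minus_le|].
    rewrite !norm_twist. apply Rplus_le_compat; apply HM.
  - assert (M = e * (M / e)) by (field; lra). nra.
Qed.

Section Eigenvector.

Variables (lambda : R) (x : X).
Hypothesis Hx : A x (minus (scal (Cmult Ci (RtoC lambda)) x) (B (wave lambda x) 0)).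

Lemma wave_eigenvector (t : R) :
  A (wave lambda x t)
    (minus (scal (Cmult Ci (RtoC lambda)) (wave lambda x t)) (B (wave lambda x) t)).
Proof.
  rewrite (autonomous_wave B hB hBaut), waveE.
  rewrite (scal_comm (Cmult Ci (RtoC lambda))), <- (scal_minus_distr_l (V := X)).
  now apply (operator_scal A hA).
Qed.

Lemma classical_wave : classical_solution A B (BUC_zero X) (wave lambda x).
Proof.
  exists (BUC_scal X (Cmult Ci (RtoC lambda)) (wave lambda x)). intros t. split.
  - assert (H := is_time_derive_twist (- lambda) (fun _ => x) t zero
      (is_derive_const (V := realify X) (x : realify X) t)).
    match type of H with is_time_derive _ _ ?l =>
      replace (BUC_fct X (BUC_scal X (Cmult Ci (RtoC lambda)) (wave lambda x)) t)
      with l; [exact H|] end.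
    simpl. rewrite (scal_zero_r (V := X)), (minus_zero_l (G := X)).
    rewrite <- (scal_opp_l (V := X)). f_equal.
    apply injective_projections; simpl; unfold opp; simpl; ring.
  - eexists. split; [apply wave_eigenvector|].
    simpl BUC_fct at 1. symmetry.
    etransitivity; [apply (plus_zero_r (G := X))|]. apply (plus_minus_r (G := X)).
Qed.

(** The wave is annihilated by [i lambda - (A + B)], so at a point of the resolvent set it equals
    the resolvent at [zero], which is zero; its value at [0] is [x]. *)
Lemma eigenvector_eq_zero :
  ~ sigma_i (operator_add (pointwise_operator A) B) lambda -> x = zero.
Proof.
  intros H. apply NNPP in H. destruct H as [Res [Hlin HR]].
  assert (E : Res zero = (wave lambda x : BUC X)).
  { apply HR. exists (scal (Cmult Ci (RtoC lambda)) (wave lambda x : BUC X)). split.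
    - exists (minus (scal (Cmult Ci (RtoC lambda)) (wave lambda x : BUC X))
                (B (wave lambda x))).
      split; [exact wave_eigenvector|].
      symmetry. apply (plus_minus_r (G := BUC_AbelianGroup X)).
    - apply (minus_eq_zero (G := BUC_AbelianGroup X)). }
  rewrite (linear_zero _ Hlin) in E.
  rewrite <- (scal_cis_0 x), <- (Rmult_0_r lambda), <- waveE.
  change (BUC_fct X (wave lambda x) 0 = zero). now rewrite <- E.
Qed.

End Eigenvector.

Lemma classical_minus (f u w : BUC X) :
  classical_solution A B f u -> classical_solution A B (BUC_zero X) w ->
  classical_solution A B f (minus u w : BUC X).
Proof.
  intros [du Hu] [dw Hw]. exists (minus du dw : BUC X). intros t.
  destruct (Hu t) as [Du [y [Hy Eu]]]. destruct (Hw t) as [Dw [z [Hz Ew]]]. split.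
  - exact (is_derive_minus (V := realify X) _ _ _ _ _ Du Dw).
  - exists (minus y z). split; [exact (operator_minus _ _ _ _ Hy Hz)|].
    change (minus (du t) (dw t) = plus (plus (minus y z) (B (minus u w) t)) (f t)).
    rewrite Eu, Ew.
    rewrite (linear_minus_X (fun g => B g t)) by now apply is_linear_eval_B.
    rewrite (minus_plus_plus X). change (BUC_zero X t) with (@zero X).
    rewrite (minus_zero_r (G := X)). f_equal. apply (minus_plus_plus X).
Qed.

(** Keep the approximating forcing terms and subtract [w] from every approximating solution. *)
Lemma strong_mild_minus (f u w : BUC X) :
  strong_mild_solution A B f u -> classical_solution A B (BUC_zero X) w ->
  strong_mild_solution A B f (minus u w : BUC X).
Proof.
  intros [fn [un [Hn [Hu Hf]]]] Hw.
  exists fn, (fun n => minus (un n) w). split; [|split; [|exact Hf]].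
  - intros n. now apply classical_minus.
  - refine (filterlim_comp_2 _ _ _ Hu (filterlim_const (opp w))
      (filterlim_plus (V := BUC_NormedModule X) u (opp w))).
Qed.

(** Induction over the finite set: at a frequency [mu] outside the Bohr spectrum of [f], the wave of
    the current coefficient solves the homogeneous equation. Subtracting it kills the coefficient at
    [mu] and changes no other. *)
Lemma remove_frequencies (f u : AP X) (S : R -> Prop) :
  strong_mild_solution A B f u -> Finite_sets.Finite R S ->
  exists v : AP X, strong_mild_solution A B f v /\
    forall lambda, S lambda -> ~ bohr_spectrum f lambda -> bohr_coef lambda v = zero.
Proof.
  intros Hu HS. induction HS as [|S HS [v [Hv IH]] mu _].
  - exists u. split; [easy|]. intros lambda [].
  - destruct (classic (bohr_spectrum f mu)) as [Hf|Hf].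
    + exists v. split; [easy|]. intros lambda [l Hl|l Hl] Hn; [now apply IH|].
      destruct Hl. now elim Hn.
    + exists (AP_minus v (wave mu (bohr_coef mu v))). split.
      * assert (Hm := bohr_coef_equation f v mu Hv).
        replace (bohr_coef mu f) with (@zero X) in Hm by (symmetry; now apply NNPP).
        rewrite (plus_zero_r (G := X)) in Hm.
        assert (Hs := strong_mild_minus f v _ Hv (classical_wave _ _ Hm)).
        (* The difference formed in [AP X] and the one formed in [BUC X] agree pointwise only, hence
           the appeal to extensionality. *)
        now rewrite (BUC_ext X (AP_minus v (wave mu (bohr_coef mu v)))
          (minus (v : BUC X) (wave mu (bohr_coef mu v)))) by easy.
      * intros lambda Hl Hn. rewrite bohr_coef_minus.
        destruct (Req_dec lambda mu) as [->|Hne].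
        { rewrite bohr_coef_wave. apply (minus_eq_zero (G := X)). }
        rewrite bohr_coef_wave_ne by easy. rewrite (minus_zero_r (G := X)).
        apply IH; [|easy]. destruct Hl as [l Hl|l Hl]; [easy|].
        now destruct Hl.
Qed.

End Spectrum.

Theorem corollary28 :
  forall (X : CompleteNormedModule C_AbsRing)
    (A : operator X) (hA : linear_operator A) (hAcl : closed_operator A)
    (B : BUC X -> BUC X) (hB : is_linear B) (hBaut : autonomous B)
    (f u : AP X)
    (hu : strong_mild_solution A B f u)
    (hfin : Finite_sets.Finite R (sigma_i (operator_add (pointwise_operator A) B))),
  exists uf : AP X,
    mild_solution A B f uf /\
    (forall lambda : R, bohr_spectrum uf lambda <-> bohr_spectrum f lambda).
Proof.
  intros X A hA hAcl B hB hBaut f u hu hfin.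
  destruct (remove_frequencies A B hA hAcl hB hBaut f u _ hu hfin) as [v [Hv Hz]].
  exists v. split; [now apply strong_mild_is_mild|]. intros lambda.
  assert (E := bohr_coef_equation A B hA hAcl hB hBaut f v lambda Hv).
  split; intros H.
  - apply NNPP. intros Hf. apply H.
    (* Where [f] has no coefficient, spectral frequencies of [v] were removed, and at the others
       [eigenvector_eq_zero] applies. *)
    destruct (classic (sigma_i (operator_add (pointwise_operator A) B) lambda))
      as [Hs|Hs]; [now apply Hz|].
    replace (bohr_coef lambda f) with (@zero X) in E by (symmetry; now apply NNPP).
    rewrite (plus_zero_r (G := X)) in E.
    now apply (eigenvector_eq_zero A B hA hB hBaut lambda).
  (* With a zero coefficient of [v] the equation reads [A 0 = - a(lambda, f)], and [A 0 = 0]. *)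
  - intros Hv0. apply H. rewrite Hv0 in E.
    replace (wave lambda zero : BUC X) with (@zero (BUC_NormedModule X)) in E.
    + rewrite (linear_zero _ (is_linear_eval_B B hB 0)) in E.
      rewrite (scal_zero_r (V := X)), (plus_zero_l (G := X)), (minus_zero_l (G := X)) in E.
      rewrite <- (opp_opp (G := X) (bohr_coef lambda f)).
      rewrite (operator_functional A hA _ _ _ E (operator_zero A hA)).
      apply (opp_zero (G := X)).
    + apply BUC_ext. intros t. symmetry. apply (scal_zero_r (V := X)).
Qed.
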